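(* Let $n\ge2$, let $A$ be an Artin algebra, and let $0\to X\xrightarrow{f}Y\xrightarrow{g}Z\to0$ be an Auslander-Reiten sequence of $\mathrm{Mor}_n(A)$. (i) If $Z\in\mathcal F_n(A)$ and $Z$ is not projective in $\mathcal F_n(A)$, then $$0\to\mathbf{Epi}X\xrightarrow{\mathbf{Epi}f}\mathbf{Epi}Y\xrightarrow{\mathbf{Epi}g}Z\to0$$ is an Auslander-Reiten sequence of $\mathcal F_n(A)$, and $$0\to\mathbf{Ker}X\xrightarrow{\mathbf{Ker}f}\mathbf{Ker}Y\xrightarrow{\mathbf{Ker}g}\mathbf{Ker}Z\to0$$ is an Auslander-Reiten sequence of $\mathcal S_n(A)$. (ii) If $X\in\mathcal S_n(A)$ and $X$ is not injective in $\mathcal S_n(A)$, then $$0\to X\xrightarrow{\mathbf{Mono}f}\mathbf{Mono}Y\xrightarrow{\mathbf{Mono}g}\mathbf{Mono}Z\to0$$ is an Auslander-Reiten sequence of $\mathcal S_n(A)$, and $$0\to\mathbf{Cok}X\xrightarrow{\mathbf{Cok}f}\mathbf{Cok}Y\xrightarrow{\mathbf{Cok}g}\mathbf{Cok}Z\to0$$ is an Auslander-Reiten sequence of $\mathcal F_n(A)$.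
   Context: $\mathrm{Mor}_n(A)$ is the category whose objects $X=X_{(\phi_i)}$ are sequences of maps of finitely generated left $A$-modules $X_n\xrightarrow{\phi_{n-1}}X_{n-1}\to\cdots\xrightarrow{\phi_1}X_1$ ($X_i$ is the $i$-th branch), with commuting families $(f_i:X_i\to Y_i)$ as morphisms; exactness is branchwise. $\mathcal S_n(A)$ (resp. $\mathcal F_n(A)$) is the full subcategory of objects with all $\phi_i$ monomorphisms (resp. epimorphisms), with the exact structure inherited from $\mathrm{Mor}_n(A)$; projective/injective objects in them are meant with respect to this exact structure. The following are functors, acting on morphisms in the natural induced way. $\mathbf{Ker}X\in\mathcal S_n(A)$ has first branch $X_n$, $i$-th branch $\mathrm{Ker}(\phi_{i-1}\cdots\phi_{n-1})$ for $2\le i\le n$, and inclusions as maps. $\mathbf{Cok}X\in\mathcal F_n(A)$ has $i$-th branch $\mathrm{Coker}(\phi_1\cdots\phi_i)$ for $1\le i\le n-1$, $n$-th branch $X_1$, and canonical epimorphisms as maps. $\mathbf{Mono}X\in\mathcal S_n(A)$ has first branch $X_1$, $i$-th branch $\mathrm{Im}(\phi_1\cdots\phi_{i-1})$ for $2\le i\le n$, and inclusions as maps. $\mathbf{Epi}X\in\mathcal F_n(A)$ has $n$-th branch $X_n$, $i$-th branch $\mathrm{Im}(\phi_i\cdots\phi_{n-1})$ for $1\le i\le n-1$, and canonical epimorphisms as maps. $\mathbf{Mono}X\cong X$ for $X\in\mathcal S_n(A)$ and $\mathbf{Epi}Z\cong Z$ for $Z\in\mathcal F_n(A)$; these identifications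 are used in the displayed sequences. *)

(* Defs.v *)
From HB Require Import structures.
From mathcomp Require Import all_boot all_order all_algebra.
From mathcomp Require Import boolp.

Set Implicit Arguments.
Unset Strict Implicit.
Unset Printing Implicit Defensive.

Import GRing.Theory.
Local Open Scope ring_scope.
Local Open Scope quotient_scope.

Section Submodules.
Variable R : nzRingType.

Record submodule (V : lmodType R) := Submodule {
  submodule_pred :> {pred V};
  submoduleP : submod_closed submodule_pred
}.

HB.instance Definition _ (V : lmodType R) (S : submodule V) :=
  GRing.isSubmodClosed.Build R V (submodule_pred S) (submoduleP S).

Record submod (V : lmodType R) (S : submodule V) : predArgType :=
  Submod { submod_val : V; submod_valP : submod_val \in submodule_pred S }.

HB.instance Definition _ (V : lmodType R) (S : submodule V) :=
  [isSub for @submod_val V S].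
HB.instance Definition _ (V : lmodType R) (S : submodule V) :=
  [Choice of submod S by <:].
HB.instance Definition _ (V : lmodType R) (S : submodule V) :=
  [SubChoice_isSubLmodule of submod S by <:].

Definition submod_map (U V : lmodType R) (S : submodule U) (T : submodule V)
    (f : {linear U -> V}) (fST : {in S, forall x, f x \in T})
    (x : submod S) : submod T :=
  Submod (fST _ (submod_valP x)).

Fact submod_map_linear (U V : lmodType R) (S : submodule U) (T : submodule V)
    (f : {linear U -> V}) (fST : {in S, forall x, f x \in T}) :
  linear (submod_map fST).
Proof. by move=> a x y; apply: val_inj; rewrite /= linearP. Qed.

HB.instance Definition _ (U V : lmodType R) (S : submodule U) (T : submodule V)
    (f : {linear U -> V}) (fST : {in S, forall x, f x \in T}) :=
  GRing.isLinear.Build R (submod S) (submod T) *:%R (submod_map fST)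
    (submod_map_linear fST).

(* The library's quotient by an additive subgroup, with the induced scaling. *)
Definition quotmod (V : lmodType R) (S : submodule V) :=
  Quotient.quot (submodule_pred S : zmodClosed V).

HB.instance Definition _ (V : lmodType R) (S : submodule V) :=
  GRing.Zmodule.on (quotmod S).

Definition quotpi (V : lmodType R) (S : submodule V) (x : V) : quotmod S :=
  \pi_(Quotient.quot (submodule_pred S : zmodClosed V)) x.

Definition quotrepr (V : lmodType R) (S : submodule V) (q : quotmod S) : V :=
  repr (q : Quotient.quot (submodule_pred S : zmodClosed V)).

Lemma quotreprK (V : lmodType R) (S : submodule V) :
  cancel (@quotrepr V S) (@quotpi V S).
Proof. exact: reprK. Qed.

Lemma quotpi_eq (V : lmodType R) (S : submodule V) (x y : V) :
  (quotpi S x == quotpi S y) = (x - y \in S).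
Proof.
by rewrite (Quotient.idealrBE (submodule_pred S : zmodClosed V)).
Qed.

Lemma quotpiD (V : lmodType R) (S : submodule V) :
  {morph @quotpi V S : x y / x + y}.
Proof. by move=> x y; rewrite /quotpi piE. Qed.

Definition quotscale (V : lmodType R) (S : submodule V) (a : R)
  (q : quotmod S) : quotmod S := quotpi S (a *: quotrepr q).

Lemma quotpiZ (V : lmodType R) (S : submodule V) (a : R) (x : V) :
  quotpi S (a *: x) = quotscale a (quotpi S x).
Proof.
apply/eqP; rewrite quotpi_eq -scalerBr rpredZ //.
by rewrite -quotpi_eq quotreprK.
Qed.

Fact quotscaleA (V : lmodType R) (S : submodule V) (a b : R) (q : quotmod S) :
  quotscale a (quotscale b q) = quotscale (a * b) q.
Proof. by rewrite -(quotreprK q) -!quotpiZ scalerA. Qed.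

Fact quotscale1 (V : lmodType R) (S : submodule V) :
  left_id 1 (@quotscale V S).
Proof. by move=> q; rewrite -(quotreprK q) -quotpiZ scale1r. Qed.

Fact quotscaleDr (V : lmodType R) (S : submodule V) :
  right_distributive (@quotscale V S) +%R.
Proof.
move=> a p q; rewrite -(quotreprK p) -(quotreprK q) -quotpiD -!quotpiZ.
by rewrite -quotpiD scalerDr.
Qed.

Fact quotscaleDl (V : lmodType R) (S : submodule V) (q : quotmod S) :
  {morph (@quotscale V S)^~ q : a b / a + b}.
Proof. by move=> a b; rewrite -(quotreprK q) -!quotpiZ -quotpiD scalerDl. Qed.

HB.instance Definition _ (V : lmodType R) (S : submodule V) :=
  GRing.Zmodule_isLmodule.Build R (quotmod S) (@quotscaleA V S)
    (@quotscale1 V S) (@quotscaleDr V S) (@quotscaleDl V S).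

Fact quotpi_linear (V : lmodType R) (S : submodule V) : linear (@quotpi V S).
Proof. by move=> a x y; rewrite quotpiD quotpiZ. Qed.

HB.instance Definition _ (V : lmodType R) (S : submodule V) :=
  GRing.isLinear.Build R V (quotmod S) *:%R (@quotpi V S) (@quotpi_linear V S).

Definition quotmod_map (U V : lmodType R) (S : submodule U) (T : submodule V)
    (f : {linear U -> V}) (fST : {in S, forall x, f x \in T})
    (q : quotmod S) : quotmod T :=
  quotpi T (f (quotrepr q)).

Lemma quotmod_mapE (U V : lmodType R) (S : submodule U) (T : submodule V)
    (f : {linear U -> V}) (fST : {in S, forall x, f x \in T}) (x : U) :
  quotmod_map fST (quotpi S x) = quotpi T (f x).
Proof.
apply/eqP; rewrite quotpi_eq -linearB fST //.
by rewrite -quotpi_eq quotreprK.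
Qed.

Fact quotmod_map_linear (U V : lmodType R) (S : submodule U) (T : submodule V)
    (f : {linear U -> V}) (fST : {in S, forall x, f x \in T}) :
  linear (quotmod_map fST).
Proof.
move=> a p q; rewrite -(quotreprK p) -(quotreprK q) -linearP !quotmod_mapE.
by rewrite !linearP.
Qed.

HB.instance Definition _ (U V : lmodType R) (S : submodule U) (T : submodule V)
    (f : {linear U -> V}) (fST : {in S, forall x, f x \in T}) :=
  GRing.isLinear.Build R (quotmod S) (quotmod T) *:%R (quotmod_map fST)
    (quotmod_map_linear fST).

Definition image_pred (U V : lmodType R) (f : {linear U -> V}) : {pred V} :=
  fun y => `[< exists x, f x = y >].

Fact image_closed (U V : lmodType R) (f : {linear U -> V}) :
  submod_closed (image_pred f).
Proof.
split=> [|a _ _ /asboolP[x <-] /asboolP[y <-]]; apply/asboolP.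
  by exists 0; rewrite linear0.
by exists (a *: x + y); rewrite linearP.
Qed.

Definition image (U V : lmodType R) (f : {linear U -> V}) : submodule V :=
  Submodule (image_closed f).

Lemma imageP (U V : lmodType R) (f : {linear U -> V}) (y : V) :
  reflect (exists x, f x = y) (y \in image f).
Proof. exact: asboolP. Qed.

Definition finitely_generated (V : lmodType R) : Prop :=
  exists (m : nat) (v : 'I_m -> V),
    forall x : V, exists a : 'I_m -> R, x = \sum_(i < m) a i *: v i.

End Submodules.

(* The ideals of k are the submodules of the regular module k^o. *)
Definition artinian (k : comNzRingType) : Prop :=
  forall I : nat -> submodule k^o,
    (forall i, {subset I i.+1 <= I i}) ->
    exists N : nat, forall i, (N <= i)%N -> I i =i I N.

Definition artin_algebra (k : comNzRingType) (A : algType k) : Prop :=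
  artinian k /\ finitely_generated (A : lmodType k).

Section MorphismSequences.
Variable R : nzRingType.

(* X_n -> ... -> X_1: branch number i + 1 is the value at i : 'I_n, and the   *)
(* map from branch j + 1 to branch i + 1, where j = i + 1, is mseq_map X e for *)
(* the proof e of that equation. Finite generation is part of in_Mor below.   *)
Record mseq (n : nat) := MSeq {
  branch :> 'I_n -> lmodType R;
  mseq_map : forall i j : 'I_n, j = i.+1 :> nat -> {linear branch j -> branch i}
}.

Arguments mseq_map {n} X {i j} e : rename.

Record mhom (n : nat) (X Y : mseq n) := MHom {
  mhom_map :> forall i : 'I_n, {linear X i -> Y i};
  mhom_comm : forall (i j : 'I_n) (e : j = i.+1 :> nat) (x : X j),
    mhom_map i (mseq_map X e x) = mseq_map Y e (mhom_map j x)
}.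

Section Category.
Variable n : nat.
Implicit Types X Y Z W : mseq n.

(* Equality of morphisms is extensional. *)
Definition mhom_eq X Y (f g : mhom X Y) : Prop := forall i, f i =1 g i.

Definition mhom_id X : mhom X X :=
  @MHom n X X (fun i => (idfun : {linear X i -> X i})) (fun _ _ _ _ => erefl).

Fact mhom_comp_comm X Y Z (g : mhom Y Z) (f : mhom X Y) (i j : 'I_n)
    (e : j = i.+1 :> nat) (x : X j) :
  (g i \o f i) (mseq_map X e x) = mseq_map Z e ((g j \o f j) x).
Proof. by rewrite /= !mhom_comm. Qed.

Definition mhom_comp X Y Z (g : mhom Y Z) (f : mhom X Y) : mhom X Z :=
  @MHom n X Z (fun i => (g i \o f i : {linear X i -> Z i}))
    (mhom_comp_comm g f).

Definition short_exact X Y Z (f : mhom X Y) (g : mhom Y Z) : Prop :=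
  forall i, [/\ injective (f i),
                forall y, (g i y = 0) <-> (exists x, f i x = y)
              & forall z, exists y, g i y = z].

(* Full subcategories of the category of sequences are given by predicates on *)
(* objects, with the exact structure inherited from it.                       *)
Definition in_Mor X : Prop := forall i, finitely_generated (X i).

Definition in_S X : Prop :=
  in_Mor X /\ forall (i j : 'I_n) (e : j = i.+1 :> nat),
    injective (mseq_map X e).

Definition in_F X : Prop :=
  in_Mor X /\ forall (i j : 'I_n) (e : j = i.+1 :> nat) (y : X i),
    exists x, mseq_map X e x = y.

Definition conflation (C : mseq n -> Prop) X Y Z
    (f : mhom X Y) (g : mhom Y Z) : Prop :=
  [/\ C X, C Y, C Z & short_exact f g].

Definition projective_in (C : mseq n -> Prop) (P : mseq n) : Prop :=
  C P /\
  forall X Y Z (f : mhom X Y) (g : mhom Y Z), conflation C f g ->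
  forall h : mhom P Z, exists h' : mhom P Y, mhom_eq (mhom_comp g h') h.

Definition injective_in (C : mseq n -> Prop) (I : mseq n) : Prop :=
  C I /\
  forall X Y Z (f : mhom X Y) (g : mhom Y Z), conflation C f g ->
  forall h : mhom X I, exists h' : mhom Y I, mhom_eq (mhom_comp h' f) h.

Definition split_mono X Y (f : mhom X Y) : Prop :=
  exists r : mhom Y X, mhom_eq (mhom_comp r f) (mhom_id X).

Definition split_epi X Y (f : mhom X Y) : Prop :=
  exists s : mhom Y X, mhom_eq (mhom_comp f s) (mhom_id Y).

Definition left_almost_split (C : mseq n -> Prop) X Y (f : mhom X Y) : Prop :=
  ~ split_mono f /\
  forall W, C W -> forall h : mhom X W, ~ split_mono h ->
    exists h' : mhom Y W, mhom_eq (mhom_comp h' f) h.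

Definition right_almost_split (C : mseq n -> Prop) Y Z (g : mhom Y Z) : Prop :=
  ~ split_epi g /\
  forall W, C W -> forall h : mhom W Z, ~ split_epi h ->
    exists h' : mhom W Y, mhom_eq (mhom_comp g h') h.

(* The definition of Auslander, Reiten and Smalo; left and right minimality of *)
(* f and g are not part of it.                                                *)
Definition AR_sequence (C : mseq n -> Prop) X Y Z
    (f : mhom X Y) (g : mhom Y Z) : Prop :=
  [/\ conflation C f g, left_almost_split C f & right_almost_split C g].

Definition branch_cast X (i j : 'I_n) (e : j = i) : {linear X j -> X i} :=
  match e in _ = i' return {linear X j -> X i'} with
  | erefl => (idfun : {linear X j -> X j})
  end.

Fact pred_branch_subproof (d : nat) (i j : 'I_n) :
  j = (d.+1 + i)%N :> nat -> (d + i < n)%N.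
Proof. by move=> e; apply: leq_trans (ltnW (ltn_ord j)); rewrite e. Qed.

(* The composite X_j -> X_{j-1} -> ... -> X_i of the d = j - i maps of X
   between branches j and i. *)
Fixpoint mseq_comp_rec X (d : nat) (i j : 'I_n) :
    j = (d + i)%N :> nat -> {linear X j -> X i} :=
  match d with
  | 0 => fun e => branch_cast X (ord_inj e)
  | d'.+1 => fun e =>
      let k := Ordinal (pred_branch_subproof e) in
      (@mseq_comp_rec X d' i k erefl \o @mseq_map n X k j e
        : {linear X j -> X i})
  end.

Definition mseq_comp X (i j : 'I_n) (le_ij : (i <= j)%N) :
    {linear X j -> X i} :=
  @mseq_comp_rec X (j - i) i j (esym (subnK le_ij)).

Lemma mseq_comp_recE X (d : nat) (i j : 'I_n) (e : j = (d + i)%N :> nat)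
  (le_ij : (i <= j)%N) (x : X j) :
  mseq_comp_rec X e x = mseq_comp X le_ij x.
Proof.
rewrite /mseq_comp; have ed : d = (j - i)%N by rewrite e addnK.
by case: _ / ed (esym _) => e'; rewrite (eq_irrelevance e e').
Qed.

Lemma mseq_comp_refl X (i : 'I_n) (le_ii : (i <= i)%N) (x : X i) :
  mseq_comp X le_ii x = x.
Proof.
rewrite -(@mseq_comp_recE X 0 i i erefl le_ii) /=.
by rewrite (eq_axiomK (ord_inj _)).
Qed.

Lemma mseq_compS X (i j k : 'I_n) (le_ij : (i <= j)%N) (le_ik : (i <= k)%N)
    (e : k = j.+1 :> nat) (x : X k) :
  mseq_comp X le_ik x = mseq_comp X le_ij (mseq_map X e x).
Proof.
have ek : k = ((j - i).+1 + i)%N :> nat by rewrite e addSn subnK.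
rewrite -(mseq_comp_recE ek) /=.
set l := Ordinal _; have lj : l = j by apply: ord_inj; rewrite /= subnK.
move: (Logic.eq_refl : l = (j - i + i)%N :> nat); move: (ek : k = l.+1 :> nat).
case: _ / (esym lj) => e' e1; rewrite (eq_irrelevance e e').
exact: mseq_comp_recE.
Qed.

Lemma mseq_compSl X (i j k : 'I_n) (le_ik : (i <= k)%N) (le_jk : (j <= k)%N)
    (e : j = i.+1 :> nat) (x : X k) :
  mseq_comp X le_ik x = mseq_map X e (mseq_comp X le_jk x).
Proof.
have [d dE] : exists d, (k - j = d)%N by exists (k - j)%N.
elim: d k le_ik le_jk x dE => [|d IHd] k le_ik le_jk x dE.
  have kj : k = j by apply/ord_inj/eqP; rewrite eqn_leq le_jk -subn_eq0 dE.
  case: _ / (esym kj) le_ik le_jk x {dE} => le_ij le_jj x.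
  by rewrite (mseq_compS (leqnn i) le_ij e) !mseq_comp_refl.
have k_gt0 : (0 < k)%N by case: (k : nat) dE.
have lt_k : (k.-1 < n)%N by rewrite prednK // ltnW.
pose l := Ordinal lt_k.
have e' : k = l.+1 :> nat by rewrite /= prednK.
have le_jl : (j <= l)%N by rewrite -ltnS -e' -subn_gt0 dE.
have le_il : (i <= l)%N by apply: leq_trans le_jl; rewrite e.
rewrite (mseq_compS le_il _ e') (mseq_compS le_jl _ e') IHd //.
by apply/eqP; rewrite -eqSS -dE e' subSn.
Qed.

Lemma mhom_mseq_comp X Y (f : mhom X Y) (i j : 'I_n) (le_ij : (i <= j)%N)
  (x : X j) : f i (mseq_comp X le_ij x) = mseq_comp Y le_ij (f j x).
Proof.
have [d dE] : exists d, (j - i = d)%N by exists (j - i)%N.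
elim: d j le_ij x dE => [|d IHd] j le_ij x dE.
  have ji : j = i by apply/ord_inj/eqP; rewrite eqn_leq le_ij -subn_eq0 dE.
  by case: _ / (esym ji) le_ij x {dE} => le_ii x; rewrite !mseq_comp_refl.
have j_gt0 : (0 < j)%N by case: (j : nat) dE.
have lt_j : (j.-1 < n)%N by rewrite prednK // ltnW.
pose l := Ordinal lt_j.
have e' : j = l.+1 :> nat by rewrite /= prednK.
have le_il : (i <= l)%N by rewrite -ltnS -e' -subn_gt0 dE.
rewrite !(mseq_compS le_il _ e') IHd ?mhom_comm //.
by apply/eqP; rewrite -eqSS -dE e' subSn.
Qed.

End Category.

Section Functors.
Variable n : nat.
Implicit Types X Y Z : mseq n.+1.

(* The composites X_n -> X_i and X_i -> X_1; they are identities for i = n and *)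
(* i = 1 respectively, so that these two cases need no separate treatment in  *)
(* the definitions of Epi and Mono.                                           *)
Definition from_top X (i : 'I_n.+1) : {linear X ord_max -> X i} :=
  mseq_comp X (leq_ord i : (i <= (ord_max : 'I_n.+1))%N).

Definition to_bot X (i : 'I_n.+1) : {linear X i -> X ord0} :=
  mseq_comp X (leq0n i : ((ord0 : 'I_n.+1) <= i)%N).

Lemma from_top_map X (i j : 'I_n.+1) (e : j = i.+1 :> nat) (x : X ord_max) :
  from_top X i x = mseq_map X e (from_top X j x).
Proof. exact: mseq_compSl. Qed.

Lemma to_bot_map X (i j : 'I_n.+1) (e : j = i.+1 :> nat) (x : X j) :
  to_bot X j x = to_bot X i (mseq_map X e x).
Proof. exact: mseq_compS. Qed.

Lemma mhom_from_top X Y (f : mhom X Y) (i : 'I_n.+1) (x : X ord_max) :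
  f i (from_top X i x) = from_top Y i (f ord_max x).
Proof. exact: mhom_mseq_comp. Qed.

Lemma mhom_to_bot X Y (f : mhom X Y) (i : 'I_n.+1) (x : X i) :
  f ord0 (to_bot X i x) = to_bot Y i (f i x).
Proof. exact: mhom_mseq_comp. Qed.

(* Branches of Ker X, as submodules of X_n: the first one is all of X_n, and  *)
(* branch i > 1 is the kernel of X_n -> X_{i-1}.                              *)
Definition Ker_pred X (i : 'I_n.+1) : {pred X ord_max} :=
  fun x => (i == ord0) || (from_top X (inord i.-1) x == 0).

Fact Ker_closed X i : submod_closed (@Ker_pred X i).
Proof.
split=> [|a x y]; rewrite !unfold_in /Ker_pred.
  by rewrite linear0 eqxx orbT.
case: eqP => //= _ /eqP x0 /eqP y0.
by rewrite linearP x0 y0 scaler0 addr0 eqxx.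
Qed.

Definition Ker_sub X i : submodule (X ord_max) := Submodule (@Ker_closed X i).

Fact Ker_map_subproof X (i j : 'I_n.+1) (e : j = i.+1 :> nat) :
  {in Ker_sub X j, forall x, idfun x \in Ker_sub X i}.
Proof.
move=> x; rewrite !unfold_in /= /Ker_pred e /= inord_val -!val_eqE /= e /=.
move=> /eqP x0; have [//|i_neq0] := eqVneq (i : nat) 0%N.
have e' : i = (inord i.-1 : 'I_n.+1).+1 :> nat.
  by rewrite inordK ?prednK ?lt0n // ltnW // ltn_ord.
by rewrite (from_top_map e') x0 linear0 eqxx.
Qed.

Definition Ker X : mseq n.+1 :=
  @MSeq n.+1 (fun i => submod (Ker_sub X i))
    (fun i j e => submod_map (Ker_map_subproof (X := X) e)).

Fact Ker_hom_subproof X Y (f : mhom X Y) (i : 'I_n.+1) :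
  {in Ker_sub X i, forall x, f ord_max x \in Ker_sub Y i}.
Proof.
move=> x; rewrite !unfold_in /= /Ker_pred; case: eqP => //= _ /eqP x0.
by rewrite -mhom_from_top x0 linear0.
Qed.

Fact Ker_hom_comm X Y (f : mhom X Y) (i j : 'I_n.+1) (e : j = i.+1 :> nat)
    (x : Ker X j) :
  submod_map (Ker_hom_subproof f (i := i)) (mseq_map (Ker X) e x) =
  mseq_map (Ker Y) e (submod_map (Ker_hom_subproof f (i := j)) x).
Proof. exact: val_inj. Qed.

Definition Ker_hom X Y (f : mhom X Y) : mhom (Ker X) (Ker Y) :=
  @MHom n.+1 (Ker X) (Ker Y) (fun i => submod_map (Ker_hom_subproof f (i := i)))
    (Ker_hom_comm f).

(* Branches of Cok X, as quotients of X_1: branch n is X_1 (the quotient by   *)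
(* 0), and branch i < n is the cokernel of X_{i+1} -> X_1.                    *)
Definition Cok_pred X (i : 'I_n.+1) : {pred X ord0} :=
  fun y => if i == ord_max then y == 0
           else y \in image (to_bot X (inord i.+1)).

Fact Cok_closed X i : submod_closed (@Cok_pred X i).
Proof.
rewrite /Cok_pred; case: (i == ord_max); last exact: submoduleP.
split=> [|a x y]; rewrite !unfold_in // => /eqP-> /eqP->.
by rewrite scaler0 addr0.
Qed.

Definition Cok_sub X i : submodule (X ord0) := Submodule (@Cok_closed X i).

Lemma in_Cok_sub X i y :
  (y \in Cok_sub X i) =
  if i == ord_max then y == 0 else y \in image (to_bot X (inord i.+1)).
Proof. by []. Qed.

Fact Cok_map_subproof X (i j : 'I_n.+1) (e : j = i.+1 :> nat) :
  {in Cok_sub X j, forall x, idfun x \in Cok_sub X i}.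
Proof.
move=> y; rewrite !in_Cok_sub /= -!val_eqE /= => y_j.
have lt_in : (i < n)%N by rewrite -ltnS -e ltn_ord.
rewrite (ltn_eqF lt_in); move: y_j; case: eqP => [_ /eqP->|/eqP jn].
  exact: (submoduleP (image _)).1.
case/imageP=> x <-; apply/imageP.
have ij : inord i.+1 = j by rewrite -e inord_val.
have e' : (inord j.+1 : 'I_n.+1) = (inord i.+1 : 'I_n.+1).+1 :> nat.
  by rewrite ij inordK // ltnS ltn_neqAle jn leq_ord.
by exists (mseq_map X e' x); rewrite -to_bot_map.
Qed.

Definition Cok X : mseq n.+1 :=
  @MSeq n.+1 (fun i => quotmod (Cok_sub X i))
    (fun i j e => quotmod_map (Cok_map_subproof (X := X) e)).

Fact Cok_hom_subproof X Y (f : mhom X Y) (i : 'I_n.+1) :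
  {in Cok_sub X i, forall x, f ord0 x \in Cok_sub Y i}.
Proof.
move=> x; rewrite !in_Cok_sub; case: eqP => [_ /eqP->|_].
  by rewrite linear0.
by case/imageP=> z <-; apply/imageP; exists (f _ z); rewrite mhom_to_bot.
Qed.

Fact Cok_hom_comm X Y (f : mhom X Y) (i j : 'I_n.+1) (e : j = i.+1 :> nat)
    (x : Cok X j) :
  quotmod_map (Cok_hom_subproof f (i := i)) (mseq_map (Cok X) e x) =
  mseq_map (Cok Y) e (quotmod_map (Cok_hom_subproof f (i := j)) x).
Proof. by rewrite -(quotreprK x) /= !quotmod_mapE. Qed.

Definition Cok_hom X Y (f : mhom X Y) : mhom (Cok X) (Cok Y) :=
  @MHom n.+1 (Cok X) (Cok Y)
    (fun i => quotmod_map (Cok_hom_subproof f (i := i))) (Cok_hom_comm f).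

Fact Mono_map_subproof X (i j : 'I_n.+1) (e : j = i.+1 :> nat) :
  {in image (to_bot X j), forall x, idfun x \in image (to_bot X i)}.
Proof.
move=> _ /imageP[x <-]; apply/imageP; exists (mseq_map X e x).
by rewrite -to_bot_map.
Qed.

Definition Mono X : mseq n.+1 :=
  @MSeq n.+1 (fun i => submod (image (to_bot X i)))
    (fun i j e => submod_map (Mono_map_subproof (X := X) e)).

Fact Mono_hom_subproof X Y (f : mhom X Y) (i : 'I_n.+1) :
  {in image (to_bot X i), forall x, f ord0 x \in image (to_bot Y i)}.
Proof.
by move=> _ /imageP[x <-]; apply/imageP; exists (f i x); rewrite mhom_to_bot.
Qed.

Fact Mono_hom_comm X Y (f : mhom X Y) (i j : 'I_n.+1) (e : j = i.+1 :> nat)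
    (x : Mono X j) :
  submod_map (Mono_hom_subproof f (i := i)) (mseq_map (Mono X) e x) =
  mseq_map (Mono Y) e (submod_map (Mono_hom_subproof f (i := j)) x).
Proof. exact: val_inj. Qed.

Definition Mono_hom X Y (f : mhom X Y) : mhom (Mono X) (Mono Y) :=
  @MHom n.+1 (Mono X) (Mono Y)
    (fun i => submod_map (Mono_hom_subproof f (i := i))) (Mono_hom_comm f).

Fact Epi_map_subproof X (i j : 'I_n.+1) (e : j = i.+1 :> nat) :
  {in image (from_top X j), forall x, mseq_map X e x \in image (from_top X i)}.
Proof.
by move=> _ /imageP[x <-]; apply/imageP; exists x; rewrite -from_top_map.
Qed.

Definition Epi X : mseq n.+1 :=
  @MSeq n.+1 (fun i => submod (image (from_top X i)))
    (fun i j e => submod_map (Epi_map_subproof (X := X) e)).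

Fact Epi_hom_subproof X Y (f : mhom X Y) (i : 'I_n.+1) :
  {in image (from_top X i), forall x, f i x \in image (from_top Y i)}.
Proof.
move=> _ /imageP[x <-]; apply/imageP; exists (f ord_max x).
by rewrite mhom_from_top.
Qed.

Fact Epi_hom_comm X Y (f : mhom X Y) (i j : 'I_n.+1) (e : j = i.+1 :> nat)
    (x : Epi X j) :
  submod_map (Epi_hom_subproof f (i := i)) (mseq_map (Epi X) e x) =
  mseq_map (Epi Y) e (submod_map (Epi_hom_subproof f (i := j)) x).
Proof. by apply: val_inj; rewrite /= mhom_comm. Qed.

Definition Epi_hom X Y (f : mhom X Y) : mhom (Epi X) (Epi Y) :=
  @MHom n.+1 (Epi X) (Epi Y)
    (fun i => submod_map (Epi_hom_subproof f (i := i))) (Epi_hom_comm f).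

(* The natural morphisms X -> Mono X and Epi Z -> Z, which are the            *)
(* identifications Mono X = X for X in S_n and Epi Z = Z for Z in F_n: see    *)
(* mono_unit_bij and epi_counit_bij.                                          *)
Definition mono_unit_fun X i (x : X i) : Mono X i :=
  Submod (introT (imageP (to_bot X i) _) (ex_intro _ x erefl)).

Fact mono_unit_linear X i : linear (@mono_unit_fun X i).
Proof. by move=> a x y; apply: val_inj; rewrite /= linearP. Qed.

HB.instance Definition _ X i :=
  GRing.isLinear.Build R (X i) (Mono X i) *:%R (@mono_unit_fun X i)
    (@mono_unit_linear X i).

Fact mono_unit_comm X (i j : 'I_n.+1) (e : j = i.+1 :> nat) (x : X j) :
  mono_unit_fun (mseq_map X e x) = mseq_map (Mono X) e (mono_unit_fun x).
Proof. by apply: val_inj; rewrite /= -to_bot_map. Qed.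

Definition mono_unit X : mhom X (Mono X) :=
  @MHom n.+1 X (Mono X) (fun i => (@mono_unit_fun X i : {linear _ -> _}))
    (@mono_unit_comm X).

Definition epi_counit_fun Z i (x : Epi Z i) : Z i := submod_val x.

Fact epi_counit_linear Z i : linear (@epi_counit_fun Z i).
Proof. by []. Qed.

HB.instance Definition _ Z i :=
  GRing.isLinear.Build R (Epi Z i) (Z i) *:%R (@epi_counit_fun Z i)
    (@epi_counit_linear Z i).

Definition epi_counit Z : mhom (Epi Z) Z :=
  @MHom n.+1 (Epi Z) Z (fun i => (@epi_counit_fun Z i : {linear _ -> _}))
    (fun _ _ _ _ => erefl).

Lemma to_bot_inj X : in_S X -> forall i, injective (to_bot X i).
Proof.
move=> [_ injX] i; have [d dE] : exists d, (i : nat) = d by exists i.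
elim: d i dE => [|d IHd] i dE x y.
  have i0 : i = ord0 by apply: ord_inj.
  by case: _ / (esym i0) x y => x y; rewrite /to_bot !mseq_comp_refl.
have lt_d : (d < n.+1)%N by rewrite ltnW // -dE.
have e : i = (Ordinal lt_d).+1 :> nat by [].
by rewrite !(to_bot_map e) => /(IHd (Ordinal lt_d) erefl)/injX.
Qed.

Lemma mono_unit_bij X : in_S X -> forall i,
  injective (mono_unit X i) /\ forall y, exists x, mono_unit X i x = y.
Proof.
move=> SX i; split=> [x y /(congr1 val)/(to_bot_inj SX) //|y].
have /imageP[x xE] := submod_valP y.
by exists x; apply: val_inj.
Qed.

Lemma from_top_surj Z : in_F Z -> forall i z, exists x, from_top Z i x = z.
Proof.
move=> [_ surjZ] i; have [d dE] : exists d, (n - i)%N = d by exists (n - i)%N.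
elim: d i dE => [|d IHd] i dE z.
  have iM : i = ord_max.
    by apply/ord_inj/eqP; rewrite eqn_leq leq_ord /= -subn_eq0 dE.
  case: _ / (esym iM) z => z.
  by exists z; rewrite /from_top mseq_comp_refl.
have lt_in : (i < n)%N by rewrite -subn_gt0 dE.
have e : (Ordinal (lt_in : (i.+1 < n.+1)%N)) = i.+1 :> nat by [].
have [y <-] := surjZ _ _ e z.
have [|x <-] := IHd _ _ y; first by rewrite /= subnS dE.
by exists x; rewrite (from_top_map e).
Qed.

Lemma epi_counit_bij Z : in_F Z -> forall i,
  injective (epi_counit Z i) /\ forall z, exists x, epi_counit Z i x = z.
Proof.
move=> FZ i; split=> [x y /val_inj //|z].
have im_z : z \in image (from_top Z i).
  exact/imageP/from_top_surj.
by exists (Submod im_z).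
Qed.

End Functors.
End MorphismSequences.

(* Main.v *)
From HB Require Import structures.
From mathcomp Require Import all_boot all_order all_algebra.
From mathcomp Require Import boolp classical_sets.
Require Import Defs.

(* Let Z in F be non-projective. Pulling a conflation of F back along a map out
   of Z that does not lift through it gives a non-split epimorphism onto Z,
   which therefore factors through g; so the kernels of the composites
   Z_n -> Z_j lift along g, which is what exactness of the Epi and Ker sequences
   amounts to. For h : Epi X -> W with W in F, the pushout P of h and
   Epi X -> X satisfies Epi P = W, so that extending X -> P along f extends h
   along Epi f. The Ker sequence inherits the almost split properties through
   the adjunction Cok -| Ker, which restricts to an equivalence between S and F.
   Part (ii) is dual. The kernels involved are finitely generated because an
   artinian commutative ring is noetherian. *)

Set Implicit Arguments.
Unset Strict Implicit.
Unset Printing Implicit Defensive.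

Import GRing.Theory.
Local Open Scope ring_scope.

(** * Finite generation *)

Section Generation.
Variable R : nzRingType.

Definition mksub (V : lmodType R) (P : V -> Prop) (P0 : P 0)
    (PP : forall a x y, P x -> P y -> P (a *: x + y)) : submodule V.
Proof.
exists (fun x => `[< P x >]); split=> [|a x y /asboolP Px /asboolP Py].
  exact/asboolP.
by apply/asboolP/PP.
Defined.

Lemma mksubP (V : lmodType R) (P : V -> Prop) P0 PP x :
  (x \in @mksub V P P0 PP) <-> P x.
Proof. by split=> [/asboolP|Px]; last apply/asboolP. Qed.

(** With the span encoded as the intersection of all submodules containing [s], an inclusion of a
    span is tested on generators; [submod_span_comb] recovers linear combinations. *)
Definition span_pred (V : lmodType R) (s : seq V) (x : V) : Prop :=
  forall T : submodule V, {subset s <= T} -> x \in T.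

Fact span_pred0 (V : lmodType R) (s : seq V) : span_pred s 0.
Proof. by move=> T _; rewrite rpred0. Qed.

Fact span_predP (V : lmodType R) (s : seq V) a x y :
  span_pred s x -> span_pred s y -> span_pred s (a *: x + y).
Proof. by move=> sx sy T sT; rewrite rpredD ?rpredZ ?sx ?sy. Qed.

Definition submod_span (V : lmodType R) (s : seq V) : submodule V :=
  mksub (@span_pred0 V s) (@span_predP V s).

Definition fg_sub (V : lmodType R) (S : submodule V) : Prop :=
  exists2 s : seq V, {subset s <= S} & {subset S <= submod_span s}.

Lemma submod_span_sub (V : lmodType R) (s : seq V) (T : submodule V) :
  {subset s <= T} -> {subset submod_span s <= T}.
Proof. by move=> sT x /mksubP; apply. Qed.

Lemma mem_submod_span (V : lmodType R) (s : seq V) :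
  {subset s <= submod_span s}.
Proof. by move=> x xs; apply/mksubP => T; apply. Qed.

(** The vectors admitting such a [c] form a submodule that contains [v] and [s]. *)
Lemma submod_span_cons (V : lmodType R) (v : V) (s : seq V) x :
  x \in submod_span (v :: s) -> exists c : R, x - c *: v \in submod_span s.
Proof.
pose P x := exists c : R, x - c *: v \in submod_span s.
have P0 : P 0 by exists 0; rewrite scale0r subr0 rpred0.
have PP a y z : P y -> P z -> P (a *: y + z).
  move=> [c yc] [d zd]; exists (a * c + d).
  by rewrite scalerDl opprD addrACA -scalerA -scalerBr rpredD // rpredZ.
move/(@submod_span_sub _ _ (mksub P0 PP)) => h;
  apply/(@mksubP _ P P0 PP)/h => {h} y.
rewrite inE => /predU1P[->|ys]; apply/mksubP.
  by exists 1; rewrite scale1r subrr rpred0.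
by exists 0; rewrite scale0r subr0 mem_submod_span.
Qed.

Lemma submod_span_comb (V : lmodType R) (s : seq V) x : x \in submod_span s ->
  exists a : 'I_(size s) -> R, x = \sum_(i < size s) a i *: s`_i.
Proof.
elim: s x => [|v s IHs] x.
  pose P (y : V) := y = 0.
  have PP a y z : P y -> P z -> P (a *: y + z).
    by rewrite /P => -> ->; rewrite scaler0 addr0.
  move/(@submod_span_sub _ _ (@mksub _ P erefl PP)) => h.
  exists (fun=> 0); rewrite big_ord0; apply/(@mksubP _ P erefl PP)/h.
  by move=> y.
case/submod_span_cons=> c /IHs[a xE].
exists (fun i => if unlift ord0 i is Some j then a j else c).
rewrite big_ord_recl /= unlift_none addrC -[LHS](subrK (c *: v)) xE.
by congr (_ + _); apply: eq_bigr => i _; rewrite liftK.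
Qed.

Lemma fg_span (V : lmodType R) :
  finitely_generated V -> exists s : seq V, forall x, x \in submod_span s.
Proof.
move=> [m [v vP]]; exists [seq v i | i <- enum 'I_m] => x.
have [a ->] := vP x; apply: rpred_sum => i _; apply/rpredZ/mem_submod_span.
by rewrite map_f // mem_enum.
Qed.

Lemma fg_sub_submod (V : lmodType R) (S : submodule V) :
  fg_sub S -> finitely_generated (submod S).
Proof.
move=> [s sS Ss]; exists (size s).
exists (fun i => Submod (sS _ (mem_nth 0 (ltn_ord i)))) => x.
have [a xE] := submod_span_comb (Ss _ (submod_valP x)); exists a.
apply: val_inj; rewrite /= [LHS]xE.
pose vl := (val : {linear submod S -> V}).
rewrite -[RHS]/(vl _) linear_sum; apply: eq_bigr => i _.
by rewrite linearZ.
Qed.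

Lemma fg_surj (U V : lmodType R) (f : {linear U -> V}) :
  (forall y, exists x, f x = y) -> finitely_generated U -> finitely_generated V.
Proof.
move=> surj_f [m [v vP]]; exists m, (f \o v) => y.
have [x <-] := surj_f y; have [a ->] := vP x; exists a.
by rewrite linear_sum; apply: eq_bigr => i _; rewrite linearZ.
Qed.

Lemma fg_prod (U V : lmodType R) :
  finitely_generated U -> finitely_generated V ->
  finitely_generated (U * V)%type.
Proof.
move=> [m [u uP]] [p [v vP]]; exists (m + p)%N.
exists (fun i => match split i with inl j => (u j, 0) | inr j => (0, v j) end).
move=> [x y]; have [a ->] := uP x; have [b ->] := vP y.
exists (fun i => match split i with inl j => a j | inr j => b j end).
have splitl i : split (lshift p i) = inl i := unsplitK (inl i).
have splitr i : split (rshift m i) = inr i := unsplitK (inr i).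
rewrite big_split_ord /=.
under [X in _ = X + _]eq_bigr do rewrite splitl.
under [X in _ = _ + X]eq_bigr do rewrite splitr.
rewrite [RHS]surjective_pairing; congr (_, _).
  rewrite (linearD fst) !(linear_sum fst) /=.
  by rewrite [X in _ = _ + X]big1 ?addr0 // => i _; rewrite scaler0.
rewrite (linearD snd) !(linear_sum snd) /=.
by rewrite [X in _ = X + _]big1 ?add0r // => i _; rewrite scaler0.
Qed.

(* rho is a relation rather than a map because the coefficient of v in a vector
   of submod_span (v :: s) need not be well defined. *)
Lemma fg_ext (V W : lmodType R) (rho : V -> W -> Prop) (S T : submodule V)
    (J : submodule W) :
  (forall a x y x' y', rho x y -> rho x' y' ->
    rho (a *: x + x') (a *: y + y')) ->
  rho 0 0 ->
  (forall x, x \in S -> rho x 0 -> x \in T) -> {subset T <= S} ->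
  (forall y, y \in J -> exists2 x, x \in S & rho x y) ->
  (forall x, x \in S -> exists2 y, y \in J & rho x y) ->
  fg_sub T -> fg_sub J -> fg_sub S.
Proof.
move=> rhoP rho0 ST TS JS SJ [t tT Tt] [c cJ Jc].
(* [F] chooses preimages in [S] under [rho]; nothing is required of it outside [J]. *)
have [F FP] : exists F : W -> V, forall y, y \in J -> F y \in S /\ rho (F y) y.
  suff h (y : W) : exists x, y \in J -> x \in S /\ rho x y.
    by exists (fun y => sval (cid (h y))) => y; case: cid.
  by case: (boolP (y \in J)) => [/JS[x ? ?]|_]; [exists x|exists 0].
exists (t ++ map F c) => [x|x Sx].
  by rewrite mem_cat => /orP[/tT/TS//|/mapP[y /cJ/FP[Fy _] ->]].
apply/mksubP => U sU.
have TU : {subset T <= U}.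
  move=> z /Tt/(submod_span_sub (T := U)); apply=> w wt.
  by apply: sU; rewrite mem_cat wt.
(* The elements related to a common member of [S] and [U] form a submodule containing [c], hence
   [J]. Subtracting such a member from [x] leaves an element of [T]. *)
pose P (y : W) := exists2 u, (u \in S) && (u \in U) & rho u y.
have P0 : P 0 by exists 0; rewrite ?rpred0.
have PP a y z : P y -> P z -> P (a *: y + z).
  move=> [u /andP[uS uU] ru] [v /andP[vS vU] rv]; exists (a *: u + v);
    last exact: rhoP.
  by rewrite !rpredD ?rpredZ.
have [y Jy rxy] := SJ _ Sx.
have /mksubP[u /andP[uS uU] ruy] : y \in mksub P0 PP.
  move: (Jc _ Jy); apply: submod_span_sub => z zc; apply/mksubP.
  have [FS Fr] := FP _ (cJ _ zc); exists (F z) => //; rewrite FS sU //.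
  by rewrite mem_cat map_f ?orbT.
rewrite -[x](subrK u) rpredD // TU // ST ?rpredB //.
have := rhoP (-1) _ _ _ _ ruy rxy.
by rewrite !scaleN1r addNr addrC.
Qed.

End Generation.

(** * Artinian commutative rings and Artin algebras *)

Section Artinian.
Variable k : comNzRingType.
Hypothesis artk : artinian k.

(** Without a minimal member, repeatedly choosing a strictly smaller one gives a descending chain
    that never stabilises. *)
Lemma artinian_min (P : submodule k^o -> Prop) (I0 : submodule k^o) : P I0 ->
  exists2 I, P I & forall J :
    submodule k^o, {subset J <= I} -> P J -> {subset I <= J}.
Proof.
move=> PI0; apply: contrapT => noI.
have step (I : {I | P I}) : exists J : {J | P J},
    {subset sval J <= sval I} /\ ~ {subset sval I <= sval J}.
  apply: contrapT => noJ; apply: noI; exists (sval I) => [|J JI PJ].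
    exact: (svalP I).
  by apply: contrapT => IJ; apply: noJ; exists (exist _ J PJ).
pose F I := sval (cid (step I)).
pose c n := iter n F (exist _ I0 PI0).
have [i|N /(_ N.+1 (leqnSn N)) eqN] := artk (I := fun n => sval (c n)).
  by rewrite /c iterS /F; case: cid => J [].
have [_] : {subset sval (c N.+1) <= sval (c N)} /\ ~ {subset sval (c N) <= sval
  (c N.+1)}.
  by rewrite /c iterS /F; case: cid.
by apply=> x; rewrite eqN.
Qed.

(* A minimal ideal I that is not finitely generated is killed by a or equal to
   aI, for every a, so it is a vector space over a field. A subspace J that is
   maximal among those avoiding some nonzero x of I is a hyperplane; it is
   finitely generated by minimality, hence so is I = J + kx. *)
Lemma artinian_fg_ideal (I0 : submodule k^o) : fg_sub I0.
Proof.
apply: contrapT => /(artinian_min (P := fun I => ~ fg_sub I))[I nfgI minI].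
(* [I] is an extension of aI by the annihilator of [a] in [I]; one of the two is not finitely
   generated, so it equals [I] by minimality. *)
have aIP (a : k) : (forall x, x \in I -> a * x = 0) \/
    (forall x, x \in I -> exists2 y, y \in I & x = a * y).
  pose PJ (y : k^o) := exists2 x, x \in I & y = a * x.
  have PJ0 : PJ 0 by exists 0; rewrite ?rpred0 ?mulr0.
  have PJP c y z : PJ y -> PJ z -> PJ (c *: y + z).
    move=> [x xI ->] [x' x'I ->]; exists (c *: x + x').
      by rewrite rpredD ?rpredZ.
    by rewrite mulrDr /GRing.scale /= mulrCA.
  have [fgJ|nfgJ] := pselect (fg_sub (mksub PJ0 PJP)); last first.
    right=> x xI; apply/(@mksubP _ _ PJ PJ0 PJP).
    apply: (minI _ _ nfgJ) => // y /mksubP[z zI ->].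
    exact: (rpredZ a).
  pose PK (x : k^o) := x \in I /\ a * x = 0.
  have PK0 : PK 0 by split; rewrite ?rpred0 ?mulr0.
  have PKP c y z : PK y -> PK z -> PK (c *: y + z).
    move=> [yI y0] [zI z0]; split; first by rewrite rpredD ?rpredZ.
    by rewrite mulrDr /GRing.scale /= mulrCA y0 z0 mulr0 addr0.
  left=> x xI; suff /mksubP[] : x \in mksub PK0 PKP by [].
  apply: minI xI => [y /mksubP[]//|fgK]; apply: nfgI.
  apply: (fg_ext (rho := fun x y : k^o => y = a * x) _ _ _ _ _ _ fgK fgJ).
  - by move=> c y _ z _ -> ->; rewrite mulrDr /GRing.scale /= mulrCA.
  - by rewrite mulr0.
  - by move=> y yI y0; apply/mksubP.
  - by move=> y /mksubP[].
  - by move=> y /mksubP[z zI ->]; exists z.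
  - by move=> y yI; exists (a * y) => //; apply/mksubP; exists y.
(* If aI = [I], stabilisation of the ideals generated by the powers of [a] gives
   [a ^+ N = c * a ^+ N.+1]. As every element of [I] is a multiple of [a ^+ N], [c * a] acts on [I]
   as the identity. *)
have inv_a (a : k) : (forall x, x \in I -> a * x = 0) \/
    exists b, forall x, x \in I -> b * a * x = x.
  have [|aI] := aIP a; [by left|right].
  pose P n (y : k^o) := exists c, y = c * a ^+ n.
  have P0 n : P n 0 by exists 0; rewrite mul0r.
  have PP n c y z : P n y -> P n z -> P n (c *: y + z).
    move=> [d ->] [e ->]; exists (c * d + e).
    by rewrite mulrDl -mulrA.
  have [n x /mksubP[c ->]|N /(_ N.+1 (leqnSn N) (a ^+ N))] :=
      artk (I := fun n => mksub (P0 n) (PP n)).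
    by apply/mksubP; exists (c * a); rewrite exprS mulrA.
  have -> : (a ^+ N : k^o) \in mksub (P0 N) (PP N).
    by apply/(@mksubP _ k^o _ (P0 N) (PP N)); exists 1; rewrite mul1r.
  move/mksubP=> [c cE]; exists c => x xI.
  have [y yI ->] : exists2 y, y \in I & x = a ^+ N * y.
    elim: N {cE} x xI => [|N IH] x xI; first by exists x; rewrite ?mul1r.
    have [y yI ->] := IH _ xI; have [z zI ->] := aI _ yI.
    by exists z; rewrite ?mulrA // exprSr.
  by rewrite mulrA -[c * a * _]mulrA -exprS -cE.
have [x xI x0] : exists2 x, x \in I & x != 0.
  apply: contrapT => noX; apply: nfgI; exists [::] => // y yI.
  have [->|y0] := eqVneq y 0; first by rewrite rpred0.
  by case: noX; exists y.
(* Zorn's lemma also has to cover the empty chain, whose union is empty; this is why 0 is not put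
   into [A] here but obtained from maximality in [A0]. *)
pose P (A : set k) := [/\ forall (a : k) y z, A y -> A z -> A (a * y + z),
  forall y, A y -> y \in I & ~ A x].
have [A [[AP AI Ax] Amax]] :
  exists A, P A /\ forall B, (A `<` B)%classic -> ~ P B.
  apply: Zorn_bigcup => F FP totF; split.
  - move=> a y z [B FB By] [C FC Cz].
    have [BC|CB] := totF _ _ FB FC.
      by exists C => //; have [CP _ _] := FP _ FC; apply: CP => //; apply: BC.
    by exists B => //; have [CP _ _] := FP _ FB; apply: CP => //; apply: CB.
  - by move=> y [B FB By]; have [_ h _] := FP _ FB; apply: h.
  - by move=> [B FB Bx]; have [_ _ h] := FP _ FB; apply: h.
have A0 : A 0.
  apply: contrapT => nA0; apply: (Amax [set 0]%classic).
    split=> [y Ay|/(_ 0 erefl)//]; exfalso; apply: nA0.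
    by have := AP (-1) _ _ Ay Ay; rewrite mulN1r addNr.
  split=> [a y z /= -> ->|y /= ->|/= xz].
  - by rewrite mulr0 addr0.
  - by exact: (rpred0 (submodule_pred I)).
  - by rewrite xz eqxx in x0.
pose J := @mksub _ k^o A A0 AP.
have JI : {subset J <= I} by move=> y /mksubP/AI.
have [fgJ|nfgJ] := pselect (fg_sub J); last first.
  by apply: Ax; apply/(@mksubP _ k^o A A0 AP)/(minI _ JI nfgJ).
case: fgJ => s sJ Js; apply: nfgI; exists (x :: s) => [y|y yI].
  by rewrite inE => /predU1P[->//|/sJ/JI].
apply/mksubP => U xsU.
have JU : {subset J <= U}.
  by move=> z /Js; apply: submod_span_sub => w ws; rewrite xsU // inE ws orbT.
have [yJ|nyJ] := boolP (y \in J); first exact: JU.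
(* B = J + ky is strictly larger than [J], so it contains [x], say x = j + cy. If [c] killed [I],
   [x] would lie in [J]; hence [c] acts invertibly and [y] is recovered from [x] and [j]. *)
pose B : set k := fun z => exists2 j, A j & exists c, z = j + c * y.
have nPB : ~ P B.
  apply: Amax; split=> [z Az|BA]; first by exists z => //; exists 0;
    rewrite mul0r addr0.
  case/negP: nyJ; apply/mksubP/BA; exists 0 => //; exists 1.
  by rewrite mul1r add0r.
have [j Aj [c xE]] : B x.
  apply: contrapT => nBx; apply: nPB; split=> //.
    move=> a z w [j Aj [c ->]] [l Al [d ->]]; exists (a * j + l);
      first exact/AP.
    by exists (a * c + d); rewrite mulrDr mulrA addrACA mulrDl.
  by move=> z [j /AI jI [c ->]]; apply: (rpredD (S := submodule_pred I)) => //;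
    exact: (rpredZ (s := submodule_pred I) c).
have [cy0|[b bc]] := inv_a c.
  by exfalso; apply: Ax; rewrite xE cy0 // addr0.
have -> : y = b *: (x - j).
  by rewrite xE addrAC subrr add0r /GRing.scale /= mulrA bc.
have Uj : j \in U by apply/JU/(@mksubP _ k^o A A0 AP).
by rewrite rpredZ // rpredB // xsU // mem_head.
Qed.

(** Induction on generators: [S] is an extension of the ideal of coefficients of [v] by its
    intersection with the span of the other generators. *)
Lemma artinian_fg_sub (V : lmodType k) (s : seq V) (S : submodule V) :
  {subset S <= submod_span s} -> fg_sub S.
Proof.
elim: s S => [|v s IHs] S Ss; first by exists [::].
pose PJ (c : k^o) := exists2 x, x \in S & x - c *: v \in submod_span s.
have rhoP a x y x' y' : x - y *: v \in submod_span s ->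
  x' - y' *: v \in submod_span s ->
    a *: x + x' - (a * y + y') *: v \in submod_span s.
  move=> xy xy'.
  by rewrite scalerDl opprD addrACA -scalerA -scalerBr rpredD // rpredZ.
have rho0 : 0 - 0 *: v \in submod_span s by rewrite scale0r subr0 rpred0.
have PJ0 : PJ 0 by exists 0; rewrite ?rpred0.
have PJP a y z : PJ y -> PJ z -> PJ (a *: y + z).
  move=> [x xS xy] [x' x'S xy']; exists (a *: x + x');
    first by rewrite rpredD ?rpredZ.
  exact: rhoP.
pose PT (x : V) := x \in S /\ x \in submod_span s.
have PT0 : PT 0 by split; rewrite ?rpred0.
have PTP a y z : PT y -> PT z -> PT (a *: y + z).
  by move=> [? ?] [? ?]; split; rewrite rpredD ?rpredZ.
have fgT : fg_sub (mksub PT0 PTP) by apply: IHs => x /mksubP[].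
have fgJ := artinian_fg_ideal (mksub PJ0 PJP).
apply: (fg_ext (rho := fun x (c : k^o) => x - c *: v \in submod_span s)
          _ _ _ _ _ _ fgT fgJ) => //.
- by move=> x xS; rewrite scale0r subr0 => xs; apply/mksubP.
- by move=> x /mksubP[].
- by move=> y /mksubP.
- move=> x xS; have [c xc] := submod_span_cons (Ss _ xS).
  by exists c => //; apply/mksubP; exists x.
Qed.

Variable A : algType k.

(** An alias of [V], so that scaling by [k] can be declared next to scaling by [A]. *)
Definition restr_scalars (V : lmodType A) : Type := V.

HB.instance Definition _ (V : lmodType A) := GRing.Zmodule.on (restr_scalars V).

Definition restr_scale (V : lmodType A) (c : k) (x : restr_scalars V) :
  restr_scalars V := (c%:A : A) *: (x : V).

Fact restr_scaleA (V : lmodType A) (c d : k) (x : restr_scalars V) :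
  restr_scale c (restr_scale d x) = restr_scale (c * d) x.
Proof. by rewrite /restr_scale scalerA -scalerAl mul1r scalerA. Qed.

Fact restr_scale1 (V : lmodType A) : left_id 1 (@restr_scale V).
Proof. by move=> x; rewrite /restr_scale !scale1r. Qed.

Fact restr_scaleDr (V : lmodType A) : right_distributive (@restr_scale V) +%R.
Proof. by move=> c x y; rewrite /restr_scale scalerDr. Qed.

Fact restr_scaleDl (V : lmodType A) (x : restr_scalars V) :
  {morph (@restr_scale V)^~ x : c d / c + d}.
Proof. by move=> c d; rewrite /restr_scale !scalerDl. Qed.

HB.instance Definition _ (V : lmodType A) :=
  GRing.Zmodule_isLmodule.Build k (restr_scalars V) (@restr_scaleA V)
    (@restr_scale1 V) (@restr_scaleDr V) (@restr_scaleDl V).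

Lemma restr_scaleE (V : lmodType A) (c : k) (x : restr_scalars V) :
  c *: x = (c%:A : A) *: (x : V) :> V.
Proof. by []. Qed.

Definition restr_sub (V : lmodType A) (S : submodule V) :
  submodule (restr_scalars V).
Proof.
apply: (@Submodule k (restr_scalars V) (submodule_pred S)).
split=> [|c x y xS yS]; first exact: (rpred0 (submodule_pred S)).
apply: (rpredD (S := submodule_pred S)) => //.
by rewrite restr_scaleE rpredZ.
Defined.

(** Products of [k]-generators of [A] with [A]-generators of [V] generate [V] over [k]. So [S] is
    finitely generated over [k], and the same vectors generate it over [A]. *)
Lemma artin_algebra_fg_submod (V : lmodType A) (S : submodule V) :
  finitely_generated (A : lmodType k) -> finitely_generated V ->
  finitely_generated (submod S).
Proof.
move=> /fg_span[e eP] /fg_span[w wP]; apply: fg_sub_submod.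
pose L : seq (restr_scalars V) := [seq a *: v | a <- e, v <- w].
have LP x : x \in submod_span L.
  apply/mksubP => T LT.
  (* The [y] with Ay inside [T] form an [A]-submodule, and for a generator [v] the [b] with bv in
     [T] form a [k]-submodule of [A]; so it suffices to test products of generators. *)
  pose P (y : V) := forall a : A, (a *: y : restr_scalars V) \in T.
  have P0 : P 0 by move=> a; rewrite scaler0 (rpred0 (submodule_pred T)).
  have PP a y z : P y -> P z -> P (a *: y + z).
    move=> yP zP b; rewrite scalerDr scalerA.
    exact: (rpredD (S := submodule_pred T)).
  suff /mksubP/(_ 1) : (x : V) \in mksub P0 PP by rewrite scale1r.
  move: (wP x); apply: submod_span_sub => v vw; apply/mksubP => a.
  pose Q (b : A) := (b *: v : restr_scalars V) \in T.
  have Q0 : Q 0 by rewrite /Q scale0r (rpred0 (submodule_pred T)).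
  have QP c y z : Q y -> Q z -> Q (c *: y + z).
    rewrite /Q => yQ zQ; rewrite scalerDl.
    apply: (rpredD (S := submodule_pred T)) => //.
    rewrite -[y]mul1r scalerAl -scalerA.
    exact: (rpredZ (s := submodule_pred T) c yQ).
  apply/(@mksubP _ _ Q Q0 QP); move: (eP a); apply: submod_span_sub => b be.
  by apply/mksubP/LT/allpairsP; exists (b, v).
have [|s sS Ss] := @artinian_fg_sub (restr_scalars V) L (restr_sub S).
  by move=> x _; apply: LP.
exists s => // x xS; apply/mksubP => U sU.
by move: (Ss _ xS); apply: (submod_span_sub (T := restr_sub U)).
Qed.

End Artinian.

(** * Pullbacks and pushouts *)

Section Morphisms.
Variables (R : nzRingType) (n : nat).
Implicit Types X Y Z W E V : mseq R n.

Lemma linear_ex (U V : lmodType R) (F : U -> V) :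
  linear F -> exists f : {linear U -> V}, f =1 F.
Proof.
move=> linF; pose L := GRing.isLinear.Build R U V *:%R F linF.
by exists (HB.pack_for {linear U -> V} F L).
Qed.

Lemma mhom_ex X Y (F : forall i : 'I_n, X i -> Y i) :
  (forall i, linear (F i)) ->
  (forall (i j : 'I_n) (e : j = i.+1 :> nat) (x : X j),
     F i (mseq_map X e x) = mseq_map Y e (F j x)) ->
  exists f : mhom X Y, forall i x, f i x = F i x.
Proof.
move=> linF commF; pose f i := sval (cid (linear_ex (linF i))).
have fE i : f i =1 F i by rewrite /f; case: cid.
have commf (i j : 'I_n) (e : j = i.+1 :> nat) (x : X j) :
    f i (mseq_map X e x) = mseq_map Y e (f j x) by rewrite !fE commF.
by exists (MHom commf).
Qed.

Lemma mhom_sub X Y (f g : mhom X Y) :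
  exists d : mhom X Y, forall i x, d i x = f i x - g i x.
Proof.
apply: (mhom_ex (F := fun i x => f i x - g i x)) => [i a x y|i j e x].
  by rewrite /= !linearP addrACA -scalerDr.
by rewrite !mhom_comm linearB.
Qed.

(** Preimages under an injective [u] are unique, so choosing them is linear and compatible with the
    structure maps. *)
Lemma mhom_lift X Y W (u : mhom X Y) (h : mhom W Y) :
  (forall i, injective (u i)) -> (forall i w, exists x, u i x = h i w) ->
  exists h' : mhom W X, forall i w, u i (h' i w) = h i w.
Proof.
move=> inj_u im_h; pose F i w := sval (cid (im_h i w)).
have FE i w : u i (F i w) = h i w by rewrite /F; case: cid.
have [||h' h'E] := @mhom_ex W X F.
- by move=> i a x y; apply: inj_u; rewrite linearP !FE linearP.
- by move=> i j e x; apply: inj_u; rewrite mhom_comm !FE mhom_comm.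
- by exists h' => i w; rewrite h'E FE.
Qed.

Lemma mhom_desc X Y W (p : mhom X Y) (h : mhom X W) :
  (forall i y, exists x, p i x = y) ->
  (forall i x, p i x = 0 -> h i x = 0) ->
  exists h' : mhom Y W, forall i x, h' i (p i x) = h i x.
Proof.
move=> surj_p ker_p; pose s i y := sval (cid (surj_p i y)).
have sE i y : p i (s i y) = y by rewrite /s; case: cid.
have hE i x x' : p i x = p i x' -> h i x = h i x'.
  move=> pxx'; apply/eqP; rewrite -subr_eq0 -linearB; apply/eqP/ker_p.
  by rewrite linearB pxx' subrr.
have [||h' h'E] := @mhom_ex Y W (fun i y => h i (s i y)).
- by move=> i a x y; rewrite -linearP; apply: hE; rewrite linearP !sE.
- by move=> i j e x; rewrite -mhom_comm; apply: hE; rewrite mhom_comm !sE.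
- by exists h' => i x; rewrite h'E; apply: hE; rewrite sE.
Qed.

(** The morphism 1 - fr vanishes on the image of [f], which is the kernel of [g], so it descends
    along [g] to a section. *)
Lemma short_exact_split_mono X Y Z (f : mhom X Y) (g : mhom Y Z) :
  short_exact f g -> split_mono f -> split_epi g.
Proof.
move=> ex_fg [r rf].
have gf i x : g i (f i x) = 0 by have [_ /(_ (f i x))[_ h] _] := ex_fg i;
  apply: h; exists x.
have [d dE] := mhom_sub (mhom_id Y) (mhom_comp f r).
have [|i y gy|s sE] := @mhom_desc Y Z Y g d.
- by move=> i; have [] := ex_fg i.
- have [_ /(_ y)[/(_ gy)[x <-] _] _] := ex_fg i.
  by have /= rfx := rf i x; rewrite dE /= rfx subrr.
- exists s => i z; have [_ _ /(_ z)[y <-]] := ex_fg i.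
  by rewrite /= sE dE linearB /= gf subr0.
Qed.

(** Dually, 1 - sg lands in the kernel of [g] and factors through [f] as a retraction. *)
Lemma short_exact_split_epi X Y Z (f : mhom X Y) (g : mhom Y Z) :
  short_exact f g -> split_epi g -> split_mono f.
Proof.
move=> ex_fg [s gs].
have gf i x : g i (f i x) = 0 by have [_ /(_ (f i x))[_ h] _] := ex_fg i;
  apply: h; exists x.
have [d dE] := mhom_sub (mhom_id Y) (mhom_comp s g).
have inj_f i : injective (f i) by have [] := ex_fg i.
have [|i y|r rE] := @mhom_lift X Y Y f d.
- exact: inj_f.
- have [_ h _] := ex_fg i; apply/h; have /= gsgy := gs i (g i y).
  by rewrite dE linearB /= gsgy subrr.
- by exists r => i x; apply: inj_f; rewrite /= rE dE /= gf linear0 subr0.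
Qed.

Section ProductMap.
Variables (U V U' V' : lmodType R).
Variables (f : {linear U -> U'}) (g : {linear V -> V'}).

Definition prod_map (w : U * V) : U' * V' := (f w.1, g w.2).

Fact prod_map_linear : linear prod_map.
Proof. by move=> a x y; rewrite /prod_map /= !linearP. Qed.

HB.instance Definition _ := GRing.isLinear.Build R (U * V)%type (U' * V')%type
  *:%R prod_map prod_map_linear.

End ProductMap.

Section Pullback.
Variables (X Y Z : mseq R n) (a : mhom X Z) (b : mhom Y Z).

Definition pullback_pred i : {pred (X i * Y i)%type} :=
  fun w => a i w.1 == b i w.2.

Fact pullback_closed i : submod_closed (@pullback_pred i).
Proof.
split=> [|c x y]; rewrite !unfold_in /pullback_pred /= ?linear0 //.
by rewrite !linearP => /eqP-> /eqP->.
Qed.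

Definition pullback_sub i := Submodule (@pullback_closed i).

Fact pullback_map_subproof (i j : 'I_n) (e : j = i.+1 :> nat) :
  {in pullback_sub j, forall w,
    prod_map (mseq_map X e) (mseq_map Y e) w \in pullback_sub i}.
Proof.
move=> w; rewrite !unfold_in /= /pullback_pred /= => /eqP abw.
by rewrite !mhom_comm abw.
Qed.

Definition pullback : mseq R n :=
  @MSeq R n (fun i => submod (pullback_sub i))
    (fun i j e => submod_map (@pullback_map_subproof i j e)).

(** The pullback is a submodule of a product, so its finite generation rests on the noetherian
    condition; the pushout, a quotient, is finitely generated over any ring. *)
Lemma pullback_ex : exists (P : mseq R n) (p : mhom P X) (q : mhom P Y),
  [/\ forall i w, a i (p i w) = b i (q i w),
      forall i x y, a i x = b i y -> exists w, p i w = x /\ q i w = y,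
      forall i w, p i w = 0 -> q i w = 0 -> w = 0
    & (forall (V : lmodType R) (S : submodule V), finitely_generated V ->
         finitely_generated (submod S)) ->
      in_Mor X -> in_Mor Y -> in_Mor P].
Proof.
have [||p pE] := @mhom_ex pullback X (fun i w => (submod_val w).1) => //.
have [||q qE] := @mhom_ex pullback Y (fun i w => (submod_val w).2) => //.
exists pullback, p, q; split.
- by move=> i w; rewrite pE qE; apply/eqP; have := submod_valP w.
- move=> i x y /eqP abxy.
  by exists (@Submod R _ (pullback_sub i) (x, y) abxy); rewrite pE qE.
- move=> i w; rewrite pE qE => p0 q0; apply: val_inj => /=.
  by rewrite [LHS]surjective_pairing p0 q0.
- by move=> noeth MX MY i; apply: noeth; apply: fg_prod.
Qed.

End Pullback.

Section Pushout.
Variables (X Y Z : mseq R n) (a : mhom Z X) (b : mhom Z Y).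

Definition pushout_rel i (z : Z i) : X i * Y i := (a i z, - b i z).

Fact pushout_rel_linear i : linear (@pushout_rel i).
Proof.
by move=> c x y; rewrite /pushout_rel !linearP.
Qed.

HB.instance Definition _ i := GRing.isLinear.Build R (Z i) (X i * Y i)%type
  *:%R (@pushout_rel i) (@pushout_rel_linear i).

Definition pushout_sub i : submodule (X i * Y i)%type := image (@pushout_rel i).

Fact pushout_map_subproof (i j : 'I_n) (e : j = i.+1 :> nat) :
  {in pushout_sub j, forall w,
    prod_map (mseq_map X e) (mseq_map Y e) w \in pushout_sub i}.
Proof.
move=> _ /imageP[z <-]; apply/imageP; exists (mseq_map Z e z).
by rewrite /= /prod_map /= linearN -!mhom_comm.
Qed.

Definition pushout : mseq R n :=
  @MSeq R n (fun i => quotmod (pushout_sub i))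
    (fun i j e => quotmod_map (@pushout_map_subproof i j e)).

Lemma pushout_ex : exists (P : mseq R n) (p : mhom X P) (q : mhom Y P),
  [/\ forall i z, p i (a i z) = q i (b i z),
      forall i w, exists x y, w = p i x + q i y,
      forall i x y, p i x + q i y = 0 -> exists z, a i z = x /\ - b i z = y
    & in_Mor X -> in_Mor Y -> in_Mor P].
Proof.
have [i c x y|i j e x|p pE] := @mhom_ex X pushout
    (fun i x => quotpi (pushout_sub i) (x, 0)).
- rewrite /= -linearP; congr quotpi.
  by rewrite -[RHS]/(c *: x + y, c *: 0 + 0) scaler0 addr0.
- rewrite /= quotmod_mapE; congr quotpi.
  by rewrite -[RHS]/(mseq_map X e x, mseq_map Y e 0) linear0.
have [i c x y|i j e x|q qE] := @mhom_ex Y pushout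
    (fun i x => quotpi (pushout_sub i) (0, x)).
- rewrite /= -linearP; congr quotpi.
  by rewrite -[RHS]/(c *: 0 + 0, c *: x + y) scaler0 addr0.
- rewrite /= quotmod_mapE; congr quotpi.
  by rewrite -[RHS]/(mseq_map X e 0, mseq_map Y e x) linear0.
have pqE i x y : p i x + q i y = quotpi (pushout_sub i) (x, y).
  rewrite pE qE -linearD; congr quotpi.
  by rewrite -[LHS]/(x + 0, 0 + y) addr0 add0r.
exists pushout, p, q; split.
- move=> i z; apply/eqP; rewrite pE qE quotpi_eq; apply/imageP; exists z.
  by rewrite -[RHS]/(a i z - 0, 0 - b i z) subr0 sub0r.
- move=> i w; exists (quotrepr w).1, (quotrepr w).2.
  rewrite pqE -{1}[w]quotreprK; congr quotpi; exact: surjective_pairing.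
- move=> i x y /eqP; rewrite pqE -(linear0 (quotpi (pushout_sub i))) quotpi_eq
    subr0.
  by case/imageP=> z [<- <-]; exists z.
- move=> MX MY i; apply: (fg_surj (f := quotpi (pushout_sub i))).
    by move=> y; exists (quotrepr y); apply: quotreprK.
  exact: fg_prod.
Qed.

End Pushout.

End Morphisms.

(** * The adjunction between Cok and Ker *)

Section Functors.
Variables (R : nzRingType) (n : nat).
Implicit Types X Y Z W E U V : mseq R n.+1.

Lemma from_top_max X x : from_top X ord_max x = x.
Proof. exact: mseq_comp_refl. Qed.

Lemma to_bot_0 X x : to_bot X ord0 x = x.
Proof. exact: mseq_comp_refl. Qed.

(** Descending induction from the last branch. It computes composites in [Cok X], with the
    projections as [t]; [to_bot_eq] does the same for [Ker X]. *)
Lemma from_top_eq X (T : Type) (t : forall i : 'I_n.+1, T -> X i) :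
  (forall (i j : 'I_n.+1) (e :
    j = i.+1 :> nat) v, t i v = mseq_map X e (t j v)) ->
  forall i v, from_top X i (t ord_max v) = t i v.
Proof.
move=> tE i v; have [d dE] : exists d, (n - i)%N = d by exists (n - i)%N.
elim: d i dE => [|d IHd] i dE.
  have iM : i = ord_max.
    by apply/ord_inj/eqP; rewrite eqn_leq leq_ord /= -subn_eq0 dE.
  by case: _ / (esym iM); rewrite from_top_max.
have lt_in : (i < n)%N by rewrite -subn_gt0 dE.
have e : (Ordinal (lt_in : (i.+1 < n.+1)%N)) = i.+1 :> nat by [].
by rewrite (from_top_map e) (tE _ _ e) IHd // /= subnS dE.
Qed.

Lemma to_bot_eq X (T : Type) (t : forall i : 'I_n.+1, X i -> T) :
  (forall (i j : 'I_n.+1) (e :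
    j = i.+1 :> nat) x, t j x = t i (mseq_map X e x)) ->
  forall i x, t ord0 (to_bot X i x) = t i x.
Proof.
move=> tE i; have [d dE] : exists d, (i : nat) = d by exists i.
elim: d i dE => [|d IHd] i dE x.
  have i0 : i = ord0 by apply: ord_inj.
  by case: _ / (esym i0) x => x; rewrite to_bot_0.
have lt_d : (d < n.+1)%N by rewrite ltnW // -dE.
have e : i = (Ordinal lt_d).+1 :> nat by [].
by rewrite (to_bot_map e) (tE _ _ e) IHd.
Qed.

Lemma val_to_bot_Ker X i (x : Ker X i) :
  submod_val (to_bot (Ker X) i x) = submod_val x.
Proof. exact: (to_bot_eq (t := fun i (x : Ker X i) => submod_val x)). Qed.

Lemma from_top_Cok X i (x : X ord0) :
  from_top (Cok X) i (quotpi (Cok_sub X ord_max) x) = quotpi (Cok_sub X i) x.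
Proof.
apply: (from_top_eq (X := Cok X) (t :=
  fun i => quotpi (Cok_sub X i))) => a b e v.
by rewrite /= quotmod_mapE.
Qed.

(** Replaces [inord] by an explicit predecessor; [ord0] has none, so there the condition is
    vacuous. *)
Lemma in_KerP X i x : x \in Ker_sub X i <->
  forall j : 'I_n.+1, i = j.+1 :> nat -> from_top X j x = 0.
Proof.
rewrite unfold_in /= /Ker_pred; split=> [h j ij|h].
  case/orP: h => [/eqP i0|/eqP]; first by rewrite i0 in ij.
  by rewrite ij /= inord_val.
have [//|i0] := eqVneq i ord0; apply/eqP/h.
have i_gt0 : (0 < i)%N by rewrite lt0n.
by rewrite inordK prednK // ltnW // ltn_ord.
Qed.

Lemma in_CokP X i y : y \in Cok_sub X i <->
  y = 0 \/ exists (j : 'I_n.+1) (x : X j), j = i.+1 :> nat /\ to_bot X j x = y.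
Proof.
rewrite in_Cok_sub; case: (eqVneq i ord_max) => [->|iM].
  split=> [/eqP|[->//|[j [x [e _]]]]]; first by left.
  by have := ltn_ord j; rewrite e ltnn.
have lt_in : (i.+1 < n.+1)%N by rewrite ltnS ltn_neqAle iM leq_ord.
split=> [/imageP[x <-]|[->|[j [x [e <-]]]]].
- by right; exists (inord i.+1), x; rewrite inordK.
- exact: (submoduleP (image _)).1.
- have -> : inord i.+1 = j by rewrite -e inord_val.
  by apply/imageP; exists x.
Qed.

Lemma quotpi_max_inj X : injective (quotpi (Cok_sub X ord_max)).
Proof.
move=> x y /eqP; rewrite quotpi_eq in_Cok_sub eqxx subr_eq0.
by move/eqP.
Qed.

Lemma in_S_Mono X : in_Mor X -> in_S (Mono X).
Proof.
move=> MX; split=> [i|i j e x y /(congr1 val) xy]; last exact: val_inj.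
apply: (fg_surj (f := mono_unit X i)) (MX i) => y.
by have /imageP[x xE] := submod_valP y; exists x; apply: val_inj.
Qed.

Lemma in_F_Epi X : in_Mor X -> in_F (Epi X).
Proof.
move=> MX; split=> [i|i j e y].
  pose F (x : X ord_max) : Epi X i :=
    Submod (introT (imageP (from_top X i) _) (ex_intro _ x erefl)).
  have [|f fE] := @linear_ex R _ _ F.
    by move=> a x y; apply: val_inj; rewrite /= linearP.
  apply: (fg_surj (f := f)) (MX ord_max) => y.
  by have /imageP[x xE] := submod_valP y; exists x; apply: val_inj; rewrite fE.
have /imageP[x xE] := submod_valP y.
have xj : from_top X j x \in image (from_top X j) by apply/imageP; exists x.
by exists (Submod xj); apply: val_inj; rewrite /= -from_top_map.
Qed.

Lemma in_F_Cok X : in_Mor X -> in_F (Cok X).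
Proof.
move=> MX; split=> [i|i j e y].
  apply: (fg_surj (f := quotpi (Cok_sub X i))) (MX ord0) => y.
  by exists (quotrepr y); apply: quotreprK.
exists (quotpi (Cok_sub X j) (quotrepr y)); rewrite /= quotmod_mapE.
exact: quotreprK.
Qed.

(** This says that [R] is left noetherian. *)
Definition fg_submodules : Prop :=
  forall (V : lmodType R) (S : submodule V),
    finitely_generated V -> finitely_generated (submod S).

Lemma in_S_Ker X : fg_submodules -> in_Mor X -> in_S (Ker X).
Proof.
move=> noeth MX; split=> [i|i j e x y /(congr1 val) xy]; last exact: val_inj.
exact: noeth.
Qed.

Lemma F_ext W X (h k : mhom W X) : in_F W ->
  (forall x, h ord_max x = k ord_max x) -> mhom_eq h k.
Proof.
move=> FW hk i w; have [x <-] := from_top_surj FW w.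
by rewrite !mhom_from_top hk.
Qed.

Lemma Cok_ext W X (h k : mhom (Cok W) X) :
  (forall x, h ord_max (quotpi (Cok_sub W ord_max) x) =
             k ord_max (quotpi (Cok_sub W ord_max) x)) -> mhom_eq h k.
Proof.
move=> hk i w; rewrite -[w]quotreprK -from_top_Cok !mhom_from_top.
by rewrite hk.
Qed.

(** The first branch of [h] maps W_1 to X_n and takes the image of W_{i+1} into the kernel of X_n ->
    X_i, so its composite with X_n -> X_i descends to [Cok W]. *)
Lemma Cok_adj W X (h : mhom W (Ker X)) : exists k : mhom (Cok W) X,
  forall i x, k i (quotpi (Cok_sub W i) x) =
    from_top X i (submod_val (h ord0 x)).
Proof.
pose F i (q : Cok W i) := from_top X i (submod_val (h ord0 (quotrepr q))).
have FE i x : F i (quotpi (Cok_sub W i) x) =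
  from_top X i (submod_val (h ord0 x)).
  apply/eqP; rewrite -subr_eq0 -linearB -(linearB val) -linearB /=.
  have : quotrepr (quotpi (Cok_sub W i) x) - x \in Cok_sub W i.
    by rewrite -quotpi_eq quotreprK.
  case/in_CokP => [->|[j [y [e <-]]]]; first by rewrite !linear0.
  rewrite mhom_to_bot val_to_bot_Ker; apply/eqP.
  by have /in_KerP/(_ _ e) := submod_valP (h j y).
have [i a x y|i j e x|k kE] := @mhom_ex _ _ (Cok W) X F.
- rewrite -[x]quotreprK -[y]quotreprK -linearP !FE.
  by rewrite !linearP.
- rewrite -[x]quotreprK; set y := quotrepr x.
  have -> : mseq_map (Cok W) e (quotpi (Cok_sub W j) y) =
    quotpi (Cok_sub W i) y.
    exact: quotmod_mapE.
  by rewrite !FE; apply: from_top_map.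
- by exists k => i x; rewrite kE FE.
Qed.

(** The inverse transposition: the last branch of [k] maps W_1 to X_n, and the image of W_i, being
    zero in branch i-1 of [Cok W], lands in branch i of [Ker X]. *)
Lemma Ker_adj W X (k : mhom (Cok W) X) : exists h : mhom W (Ker X),
  forall i w, submod_val (h i w) =
    k ord_max (quotpi (Cok_sub W ord_max) (to_bot W i w)).
Proof.
pose v i w := k ord_max (quotpi (Cok_sub W ord_max) (to_bot W i w)).
have vK i w : v i w \in Ker_sub X i.
  apply/in_KerP => j e; rewrite /v -mhom_from_top from_top_Cok.
  apply/eqP; rewrite -(linear0 (k j)) -(linear0 (quotpi (Cok_sub W j))).
  apply/eqP; congr (k j _); apply/eqP; rewrite quotpi_eq subr0; apply/in_CokP.
  by right; exists i, w.
have [i a x y|i j e x|h hE] :=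
  @mhom_ex _ _ W (Ker X) (fun i w => Submod (vK i w)).
- by apply: val_inj; rewrite /= /v !linearP.
- by apply: val_inj; rewrite /= /v -to_bot_map.
- by exists h => i w; rewrite hE.
Qed.

(* The unit X -> Ker (Cok X) has image Mono X; it is bijective for X in S. *)
Lemma Cok_unit X : exists u : mhom X (Ker (Cok X)),
  (forall i x, submod_val (u i x) =
    quotpi (Cok_sub X ord_max) (to_bot X i x)) /\
  (forall i y, exists x, u i x = y).
Proof.
have [u uE] := Ker_adj (mhom_id (Cok X)); exists u; split=> // i y.
rewrite /= in uE.
have [z zE] : exists z, quotpi (Cok_sub X ord_max) z = submod_val y.
  by exists (quotrepr (submod_val y)); apply: quotreprK.
suff [x xz] : exists x, to_bot X i x = z.
  by exists x; apply: val_inj; rewrite /= -zE -xz; apply: uE.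
have [i0|i0] := eqVneq i ord0.
  by case: _ / (esym i0) => {y zE}; exists z; rewrite to_bot_0.
have lt_i : (i.-1 < n.+1)%N by apply: leq_ltn_trans (ltn_ord i);
  rewrite leq_pred.
have e : i = (Ordinal lt_i).+1 :> nat by rewrite /= prednK ?lt0n.
have /in_KerP/(_ _ e) := submod_valP y.
rewrite -zE from_top_Cok => /eqP.
rewrite -(linear0 (quotpi (Cok_sub X (Ordinal lt_i)))) quotpi_eq subr0.
case/in_CokP=> [->|[j [x [ej <-]]]]; first by exists 0; rewrite linear0.
have ij : j = i by apply: ord_inj; rewrite ej.
by case: _ / ij x => x; exists x.
Qed.

(* The counit Cok (Ker X) -> X has image Epi X; it is bijective for X in F. *)
Lemma Ker_counit X : exists c : mhom (Cok (Ker X)) X,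
  [/\ forall i x, c i (quotpi (Cok_sub (Ker X) i) x) =
    from_top X i (submod_val x),
      forall i, injective (c i)
    & forall x, exists q, c ord_max q = x].
Proof.
have [c cE] := Cok_adj (mhom_id (Ker X)).
(* The kernel of X_n -> X_i is branch i+1 of [Ker X], exactly what branch i of [Cok (Ker X)] divides
   out. *)
have ker_c i (x : Ker X ord0) :
    from_top X i (submod_val x) = 0 -> x \in Cok_sub (Ker X) i.
  have [->|iM] := eqVneq i ord_max.
    by rewrite from_top_max => x0; apply/in_CokP; left; apply: val_inj.
  move=> x0; apply/in_CokP.
  have lt_i : (i.+1 < n.+1)%N by rewrite ltnS ltn_neqAle iM leq_ord.
  have xK : submod_val x \in Ker_sub X (Ordinal lt_i).
    by apply/in_KerP => j [] ij; have -> : j = i by apply: ord_inj.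
  right; exists (Ordinal lt_i), (Submod xK); split=> //.
  apply: val_inj.
  exact: (@val_to_bot_Ker X (Ordinal lt_i) (Submod xK)).
exists c; split=> // [i|x].
  suff ker0 q : c i q = 0 -> q = 0 by apply: raddf_inj.
  rewrite -[q]quotreprK cE /= => /ker_c q0.
  rewrite -(linear0 (quotpi (Cok_sub (Ker X) i))); apply/eqP.
  by rewrite quotpi_eq subr0.
have xK : x \in Ker_sub X ord0 by apply/in_KerP.
by exists (quotpi _ (Submod xK)); rewrite cE /= from_top_max.
Qed.

Lemma Ker0_surj X (x : X ord_max) : exists y : Ker X ord0, submod_val y = x.
Proof.
have xK : x \in Ker_sub X ord0 by apply/in_KerP.
by exists (Submod xK).
Qed.

(** [v] is composed with the inverse of the unit, bijective for [U] in S; the result is recorded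
    through U_1, into which all branches of [U] embed. *)
Lemma Ker_lift U V (v : mhom V (Ker (Cok U))) : in_S U ->
  exists t : mhom V U, forall i x,
    quotpi (Cok_sub U ord_max) (to_bot U i (t i x)) = submod_val (v i x).
Proof.
move=> SU; have [u [uE surj_u]] := Cok_unit U.
have [i x y|i x|t tE] := mhom_lift (u := u) (h := v).
- move=> /(congr1 val) /=; rewrite !uE => /quotpi_max_inj.
  exact: to_bot_inj.
- exact: surj_u.
- by exists t => i x; rewrite -uE tE.
Qed.

(** Fullness of [Cok] towards objects of S: transpose [m], then invert the unit. *)
Lemma Cok_full U V (m : mhom (Cok V) (Cok U)) : in_S U ->
  exists t : mhom V U, forall i x,
    quotpi (Cok_sub U ord_max) (to_bot U i (t i x)) =
    m ord_max (quotpi (Cok_sub V ord_max) (to_bot V i x)).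
Proof.
move=> SU; have [v vE] := Ker_adj m.
by have [t tE] := Ker_lift v SU; exists t => i x; rewrite tE vE.
Qed.

(** Fullness of [Ker] on maps from objects of F: the transpose of [m] descends along the counit of
    [U], which is bijective. *)
Lemma Ker_full U X (m : mhom (Ker U) (Ker X)) : in_F U ->
  exists t : mhom U X, forall x : Ker U ord0,
    t ord_max (submod_val x) = submod_val (m ord0 x).
Proof.
move=> FU; have [k kE] := Cok_adj m; have [c [cE inj_c surj_c]] := Ker_counit U.
have [i y|i q cq0|t tE] := mhom_desc (p := c) (h := k).
- have [x <-] := from_top_surj FU y; have [q <-] := surj_c x.
  by exists (from_top _ i q); rewrite mhom_from_top.
- have -> : q = 0 by apply: (inj_c i); rewrite cq0 linear0.
  by rewrite linear0.
- exists t => x; have := cE ord_max x; rewrite from_top_max => <-.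
  by rewrite tE kE from_top_max.
Qed.

End Functors.

(** * Transfer of Auslander-Reiten sequences *)

Section AlmostSplit.
Variables (R : nzRingType) (n : nat).
Implicit Types W E V : mseq R n.+1.
Hypothesis noeth : fg_submodules R.
Variables (X Y Z : mseq R n.+1) (f : mhom X Y) (g : mhom Y Z).
Hypothesis ARfg : AR_sequence (@in_Mor R n.+1) f g.

Let MX : in_Mor X. Proof. by case: ARfg => -[]. Qed.
Let MY : in_Mor Y. Proof. by case: ARfg => -[]. Qed.
Let MZ : in_Mor Z. Proof. by case: ARfg => -[]. Qed.
Let f_inj i : injective (f i).
Proof. by case: ARfg => -[_ _ _ /(_ i)[]]. Qed.
Let fg_ker i y : g i y = 0 -> exists x, f i x = y.
Proof. by case: ARfg => -[_ _ _ /(_ i)[_ /(_ y)[]]]. Qed.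
Let gf0 i x : g i (f i x) = 0.
Proof. by case: ARfg => -[_ _ _ /(_ i)[_ h _]] _ _; apply/h; exists x. Qed.
Let g_surj i z : exists y, g i y = z.
Proof. by case: ARfg => -[_ _ _ /(_ i)[_ _ /(_ z)]]. Qed.
Let f_nsplit : ~ split_mono f. Proof. by case: ARfg => _ []. Qed.
Let g_nsplit : ~ split_epi g. Proof. by case: ARfg => _ _ []. Qed.
Let f_ext W (h : mhom X W) : in_Mor W -> ~ split_mono h ->
  exists h' : mhom Y W, forall i x, h' i (f i x) = h i x.
Proof. by case: ARfg => _ [_ fas] _ /fas; apply. Qed.
Let g_lift W (h : mhom W Z) : in_Mor W -> ~ split_epi h ->
  exists h' : mhom W Y, forall i x, g i (h' i x) = h i x.
Proof. by case: ARfg => _ _ [_ gas] /gas; apply. Qed.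

Lemma ker_from_top_surj : in_F Z -> ~ projective_in (@in_F R n.+1) Z ->
  forall j z, from_top Z j z = 0 ->
  exists2 y, g ord_max y = z & from_top Y j y = 0.
Proof.
move=> FZ nprojZ j z z0.
have [X' [Y' [Z' [f' [g' [[FX FY FZ' ex] [h nlift]]]]]]] :
    exists X' Y' Z' (f' : mhom X' Y') (g' : mhom Y' Z'),
      conflation (@in_F R n.+1) f' g' /\
      exists h : mhom Z Z', ~ exists h' :
        mhom Z Y', mhom_eq (mhom_comp g' h') h.
  apply: contrapT => nex; apply: nprojZ; split=> // X' Y' Z' f' g' conf h.
  by apply: contrapT => nlift; apply: nex; exists X', Y', Z', f', g';
    split=> //; exists h.
have [P [p [q [pq Pex Pinj /(_ noeth MZ FY.1) MP]]]] := pullback_ex h g'.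
have [|l lE] := @g_lift P p MP.
  move=> [s ps]; apply: nlift; exists (mhom_comp q s) => i x /=.
  by rewrite -pq; congr (h i _); apply: ps.
(* A preimage of h(z) is corrected by an element of X'_n, available because X'_n -> X'_j is onto. *)
have [y' gy' y'0] : exists2 y', g' ord_max y' =
  h ord_max z & from_top Y' j y' = 0.
  have [_ _ /(_ (h ord_max z))[y gy]] := ex ord_max.
  have [_ /(_ (from_top Y' j y))[kg _] _] := ex j.
  case: kg => [|x xE]; first by rewrite mhom_from_top gy -mhom_from_top z0
    linear0.
  have [x1 x1E] := from_top_surj FX x.
  have [_ /(_ (f' ord_max x1))[_ kg] _] := ex ord_max.
  exists (y - f' ord_max x1).
    by rewrite linearB gy kg ?subr0 //; exists x1.
  by rewrite linearB -mhom_from_top x1E xE subrr.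
(* The pair (z, y') is a point of the pullback that vanishes in branch j; [l] carries it to [Y]. *)
have [w [pw qw]] := Pex ord_max z y' (esym gy').
exists (l ord_max w); first by rewrite lE.
suff w0 : from_top P j w = 0 by rewrite -mhom_from_top w0 linear0.
by apply: Pinj; rewrite mhom_from_top ?pw ?qw.
Qed.

(** Dual to [ker_from_top_surj], by a pushout along a map into [X] that does not extend. It gives
    exactness of the Mono sequence in the middle and of the Cok sequence on the left. *)
Lemma im_to_bot_pullback : in_S X -> ~ injective_in (@in_S R n.+1) X ->
  forall j x y, f ord0 x = to_bot Y j y -> exists x', to_bot X j x' = x.
Proof.
move=> SX ninjX j x y fxy.
have [X' [Y' [Z' [f' [g' [[SX' SY SZ ex] [h next]]]]]]] :
    exists X' Y' Z' (f' : mhom X' Y') (g' : mhom Y' Z'),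
      conflation (@in_S R n.+1) f' g' /\
      exists h : mhom X' X, ~ exists h' :
        mhom Y' X, mhom_eq (mhom_comp h' f') h.
  apply: contrapT => nex; apply: ninjX; split=> // X' Y' Z' f' g' conf h.
  by apply: contrapT => next; apply: nex; exists X', Y', Z', f', g';
    split=> //; exists h.
have [P [p [q [pq Pex P0 /(_ MX SY.1) MP]]]] := pushout_ex h f'.
have [|l lE] := @f_ext P p MP.
  move=> [r rp]; apply: next; exists (mhom_comp r q) => i x0 /=.
  by rewrite -pq; apply: rp.
(* Write l(y) = p(a) + q(b) in branch j. Comparing with p(x) in the first branch yields [x1] in X'_1
   mapping to x - a under [h] and to b under [f'], with a and b pushed down to the first branch. *)
have [a [b lyE]] := Pex j (l j y).
have p0 : p ord0 (x - to_bot X j a) + q ord0 (- to_bot Y' j b) = 0.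
  rewrite linearB linearN -addrA -opprD -lE fxy !mhom_to_bot lyE.
  by rewrite -linearD subrr.
have [x1 [hx1 /oppr_inj fx1]] := P0 _ _ _ p0.
have gf' i x0 : g' i (f' i x0) = 0.
  by have [_ /(_ (f' i x0))[_ k] _] := ex i; apply: k; exists x0.
(* Since Z' is in S, this can be checked in the first branch; then b, and with it [x1], comes from
   X'_j. *)
have gb : g' j b = 0.
  by apply: (to_bot_inj SZ); rewrite -mhom_to_bot -fx1 gf' linear0.
have [_ /(_ b)[/(_ gb)[x2 fx2] _] _] := ex j.
have x12 : x1 = to_bot X' j x2.
  by have [f'_inj _ _] := ex ord0; apply: f'_inj; rewrite mhom_to_bot fx2.
exists (h j x2 + a); rewrite linearD -mhom_to_bot -x12 hx1.
by rewrite subrK.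
Qed.

(* E stands for Epi X and for the isomorphic object Cok (Ker X). *)
Lemma left_ext_F E V W (u : mhom E X) (v : mhom V Y) (f' : mhom E V)
    (h : mhom E W) :
  in_F E -> in_F V -> in_F W -> (forall i, injective (u i)) ->
  (forall x, exists e, u ord_max e = x) ->
  (forall i e, v i (f' i e) = f i (u i e)) -> ~ split_mono h ->
  exists h' : mhom V W, forall i e, h' i (f' i e) = h i e.
Proof.
move=> FE FV FW inj_u surj_u vf' nsplit_h.
have [P [p [q [pq Pex P0 /(_ FW.1 MX) MP]]]] := pushout_ex h u.
have inj_p i : injective (p i).
  suff ker_p w : p i w = 0 -> w = 0 by apply: raddf_inj.
  move=> pw; have [|e [<- /eqP]] := P0 i w 0; first by rewrite linear0 addr0.
  rewrite oppr_eq0 => /eqP ue0.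
  have -> : e = 0 by apply: (inj_u i); rewrite ue0 linear0.
  by rewrite linear0.
(* Together with injectivity of [p], this identifies [W] with Epi P. *)
have im_p z : exists w, p ord_max w = z.
  have [w [x ->]] := Pex ord_max z; have [e <-] := surj_u x.
  by exists (w + h ord_max e); rewrite linearD pq.
have [|l lE] := @f_ext P q MP.
  move=> [r rq]; apply: nsplit_h.
  (* A retraction r of [q] would give rp : W -> X, which factors through [u] because [W] is in F;
     the factor would retract [h]. *)
  have [i|i w|t tE] := mhom_lift (u := u) (h := mhom_comp r p).
  - exact: inj_u.
  - have [w' <-] := from_top_surj FW w; have [e ue] := surj_u (r _ (p _ w')).
    by exists (from_top E i e); rewrite mhom_from_top ue /= !mhom_from_top.
  - exists t => i e /=; apply: (inj_u i); rewrite tE /= pq.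
    exact: rq.
have [i|i y|h' h'E] := mhom_lift (u := p) (h := mhom_comp l v).
- exact: inj_p.
- have [y' <-] := from_top_surj FV y; have [w pw] := im_p (l _ (v _ y')).
  by exists (from_top W i w); rewrite mhom_from_top pw /= !mhom_from_top.
- exists h' => i e; apply: inj_p; rewrite h'E /= vf' lE.
  by rewrite pq.
Qed.

(* E stands for Mono Z and for the isomorphic object Ker (Cok Z). *)
Lemma right_lift_S E V W (u : mhom Z E) (v : mhom Y V) (g' : mhom V E)
    (h : mhom W E) :
  in_S E -> in_S V -> in_S W -> (forall i e, exists z, u i z = e) ->
  injective (u ord0) ->
  (forall i y, g' i (v i y) = u i (g i y)) -> ~ split_epi h ->
  exists h' : mhom W V, forall i w, g' i (h' i w) = h i w.
Proof.
move=> SE SV SW surj_u inj_u g'v nsplit_h.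
have [P [p [q [pq Pex Pinj /(_ noeth SW.1 MZ) MP]]]] := pullback_ex h u.
have surj_p i w : exists z, p i z = w.
  have [z /esym/Pex[w' [<- _]]] := surj_u i (h i w).
  by exists w'.
(* Together with surjectivity of [p], this identifies [W] with Mono P. *)
have inj_p0 w : p ord0 w = 0 -> w = 0.
  move=> pw; apply: Pinj => //; apply: inj_u.
  by rewrite -pq pw !linear0.
have [|l lE] := @g_lift P q MP.
  move=> [s qs]; apply: nsplit_h.
  (* A section s of [q] would make ps descend along [u] to a section of [h]: the kernel of [u] dies
     in Z_1, and [W] is in S. *)
  have [i e|i z uz|t tE] := mhom_desc (p := u) (h := mhom_comp p s).
  - exact: surj_u.
  - apply: (to_bot_inj SW); rewrite linear0 -mhom_to_bot.
    have -> : to_bot Z i z = 0; last by rewrite linear0.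
    by apply: inj_u; rewrite mhom_to_bot uz !linear0.
  - exists t => i e; have [z <-] := surj_u i e.
    rewrite /= tE /= pq; congr (u i _); exact: qs.
have [i w|i w pw|h' h'E] := mhom_desc (p := p) (h := mhom_comp v l).
- exact: surj_p.
- apply: (to_bot_inj SV); rewrite linear0 -mhom_to_bot.
  have -> : to_bot P i w = 0; last by rewrite linear0.
  by apply: inj_p0; rewrite mhom_to_bot pw linear0.
- exists h' => i w; have [z <-] := surj_p i w.
  by rewrite h'E /= g'v lE pq.
Qed.

(** * The four transferred sequences *)

Lemma AR_Epi : in_F Z -> ~ projective_in (@in_F R n.+1) Z ->
  AR_sequence (@in_F R n.+1)
    (Epi_hom f) (mhom_comp (epi_counit Z) (Epi_hom g)).
Proof.
move=> FZ nprojZ.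
have ex : short_exact (Epi_hom f) (mhom_comp (epi_counit Z) (Epi_hom g)).
  move=> i; split.
  - by move=> x y /(congr1 val) /= /f_inj xy; apply: val_inj.
  - move=> y; split=> [gy|[x <-]]; last exact: gf0.
    have /imageP[y' y'E] := submod_valP y.
    (* g(y') lies in the kernel of Z_n -> Z_i; subtracting the lift [y1] moves y' into the image of
       [f] without changing [y]. *)
    have [|y1 gy1 y10] := ker_from_top_surj FZ nprojZ (j := i) (z :=
      g ord_max y').
      by rewrite -mhom_from_top y'E.
    have [x xE] : exists x, f ord_max x = y' - y1.
      by apply: fg_ker; rewrite linearB gy1 subrr.
    have xi : from_top X i x \in image (from_top X i) by apply/imageP; exists x.
    exists (Submod xi); apply: val_inj; rewrite /= mhom_from_top xE.
    by rewrite linearB y10 subr0.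
  - move=> z; have [z' <-] := from_top_surj FZ z; have [y <-] := g_surj z'.
    have yi : from_top Y i y \in image (from_top Y i) by apply/imageP; exists y.
    by exists (Submod yi); rewrite -mhom_from_top.
have nsplit_g : ~ split_epi (mhom_comp (epi_counit Z) (Epi_hom g)).
  by move=> [s gs]; apply: g_nsplit; exists (mhom_comp (epi_counit Y) s).
split; first by split=> //; apply: in_F_Epi.
  split=> [/(short_exact_split_mono ex)//|W FW h nsplit_h].
  have [||//|//|h' h'E] := left_ext_F (u := epi_counit X) (v := epi_counit Y)
    (f' := Epi_hom f) (h := h) (in_F_Epi MX) (in_F_Epi MY) FW.
  - by move=> i; apply: val_inj.
  - move=> x; have xi : x \in image (from_top X ord_max).
      by apply/imageP; exists x; rewrite from_top_max.
    by exists (Submod xi).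
  - by exists h'.
split=> // W FW h nsplit_h; have [l lE] := g_lift FW.1 nsplit_h.
(* As [W] is in F, the lift [l] lands in [Epi Y]. *)
have [i|i w|h' h'E] := mhom_lift (u := epi_counit Y) (h := l).
- exact: val_inj.
- have [w' <-] := from_top_surj FW w.
  have wi : l i (from_top W i w') \in image (from_top Y i).
    by apply/imageP; exists (l _ w'); rewrite mhom_from_top.
  by exists (Submod wi).
- by exists h' => i w; rewrite -lE -h'E.
Qed.

Lemma AR_Ker : in_F Z -> ~ projective_in (@in_F R n.+1) Z ->
  AR_sequence (@in_S R n.+1) (Ker_hom f) (Ker_hom g).
Proof.
move=> FZ nprojZ.
have ex : short_exact (Ker_hom f) (Ker_hom g).
  move=> i; split.
  - by move=> x y /(congr1 val) /= /f_inj xy; apply: val_inj.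
  - move=> y; split=> [/(congr1 val) gy|[x <-]]; last by apply: val_inj;
      apply: gf0.
    have [x xE] := fg_ker gy.
    have xi : x \in Ker_sub X i.
      apply/in_KerP => j e; apply: f_inj; rewrite mhom_from_top xE linear0.
      by have /in_KerP/(_ _ e) := submod_valP y.
    by exists (Submod xi); apply: val_inj.
  - move=> z; suff [y yi gy] : exists2 y, y \in Ker_sub Y i & g ord_max y =
      submod_val z.
      by exists (Submod yi); apply: val_inj.
    have [i0|i0] := eqVneq i ord0.
      have [y gy] := g_surj (submod_val z); exists y => //.
      by apply/in_KerP => j; rewrite i0.
    have lt_i : (i.-1 < n.+1)%N by apply: leq_ltn_trans (ltn_ord i);
      rewrite leq_pred.
    have e : i = (Ordinal lt_i).+1 :> nat by rewrite /= prednK ?lt0n.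
    have /in_KerP/(_ _ e) := submod_valP z.
    case/(ker_from_top_surj FZ nprojZ) => y gy y0; exists y => //.
    apply/in_KerP => j ej; suff -> : j = Ordinal lt_i by [].
    by apply: ord_inj; apply: succn_inj; rewrite -ej.
have nsplit_g : ~ split_epi (Ker_hom g).
  move=> [s gs]; have [t tE] := Ker_full s FZ.
  apply: g_nsplit; exists t; apply: F_ext => // z.
  have [x <-] := Ker0_surj z; rewrite /= tE.
  by have /(congr1 val) := gs ord0 x.
split; first by split=> //; apply: in_S_Ker.
  split=> [/(short_exact_split_mono ex)//|W SW h nsplit_h].
  have [c [cE inj_c surj_c]] := Ker_counit X.
  have [d [dE _ _]] := Ker_counit Y.
  (* [h] is moved to F by [Cok], extended there, and brought back by fullness of [Cok]. *)
  have [|||||||m mE] := left_ext_F (u := c) (v := d) (f' := Cok_hom (Ker_hom f))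
    (h := Cok_hom h) => //.
  - by apply: in_F_Cok; apply: (in_S_Ker _ _).1.
  - by apply: in_F_Cok; apply: (in_S_Ker _ _).1.
  - by apply: in_F_Cok; case: SW.
  - move=> i q; rewrite -[q]quotreprK /= quotmod_mapE dE cE /=.
    by rewrite mhom_from_top.
  - move=> [r rh]; apply: nsplit_h.
    have [t tE] := Cok_full r (in_S_Ker noeth MX); exists t => i x /=.
    apply: (to_bot_inj (in_S_Ker noeth MX)); apply: quotpi_max_inj.
    rewrite tE -mhom_to_bot -[RHS]rh /=; congr (r _ _).
    by rewrite quotmod_mapE.
  have [t tE] := Cok_full m SW; exists t => i x.
  apply: (to_bot_inj SW); apply: quotpi_max_inj.
  rewrite -[mhom_comp t _ i x]/(t i (Ker_hom f i x)) tE -!mhom_to_bot.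
  have := mE ord_max (quotpi _ (to_bot _ i x)).
  by rewrite /= !quotmod_mapE.
split=> // W SW h nsplit_h; have [k kE] := Cok_adj h.
(* A section s of the transpose [k] would give one of [h]: apply [Ker] to s and invert the unit of
   [W]. *)
have [|l lE] := @g_lift _ k (in_F_Cok SW.1).1.
  move=> [s ks]; apply: nsplit_h; have [t tE] := Ker_lift (Ker_hom s) SW.
  exists t => i z; apply: val_inj; rewrite /= -val_to_bot_Ker -mhom_to_bot.
  rewrite -[LHS]from_top_max -kE tE /=; exact: ks.
have [h' h'E] := Ker_adj l; exists h' => i w; apply: val_inj.
rewrite /= h'E lE kE from_top_max.
by rewrite mhom_to_bot val_to_bot_Ker.
Qed.

Lemma AR_Mono : in_S X -> ~ injective_in (@in_S R n.+1) X ->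
  AR_sequence (@in_S R n.+1)
    (mhom_comp (Mono_hom f) (mono_unit X)) (Mono_hom g).
Proof.
move=> SX ninjX.
have ex : short_exact (mhom_comp (Mono_hom f) (mono_unit X)) (Mono_hom g).
  move=> i; split.
  - by move=> x y /(congr1 val) /= /f_inj/(to_bot_inj SX).
  - move=> y; split=> [/(congr1 val) gy|[x <-]]; last by apply: val_inj;
      apply: gf0.
    have [x xE] := fg_ker gy; have /imageP[y' y'E] := submod_valP y.
    have [|x' x'E] := im_to_bot_pullback SX ninjX (j := i) (x := x) (y := y').
      by rewrite xE y'E.
    by exists x'; apply: val_inj; rewrite /= x'E.
  - move=> z; have /imageP[z' z'E] := submod_valP z; have [y gy] := g_surj z'.
    by exists (mono_unit Y i y); apply: val_inj; rewrite /= mhom_to_bot gy.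
have nsplit_f : ~ split_mono (mhom_comp (Mono_hom f) (mono_unit X)).
  move=> [r rf]; apply: f_nsplit; exists (mhom_comp r (mono_unit Y)) => i x.
  rewrite -[RHS]rf /=; congr (r i _); apply: val_inj.
  by rewrite /= mhom_to_bot.
split; first by split=> //; apply: in_S_Mono.
  split=> // W SW h nsplit_h; have [l lE] := f_ext SW.1 nsplit_h.
  (* As [W] is in S, the extension [l] kills the kernel of Y -> Mono Y. *)
  have [i y|i y /(congr1 val) /= y0|h' h'E] := mhom_desc (p :=
    mono_unit Y) (h := l).
  - have /imageP[y' y'E] := submod_valP y; exists y'; exact: val_inj.
  - by apply: (to_bot_inj SW); rewrite -mhom_to_bot y0 !linear0.
  - exists h' => i x; rewrite -lE -h'E /=; congr (h' i _); apply: val_inj.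
    by rewrite /= mhom_to_bot.
split=> [/(short_exact_split_epi ex)//|W SW h nsplit_h].
have [|||//|h' h'E] := right_lift_S (u := mono_unit Z) (v := mono_unit Y)
    (g' := Mono_hom g) (h := h) (in_S_Mono MZ) (in_S_Mono MY) SW.
- by move=> i e; have /imageP[y' y'E] := submod_valP e; exists y';
    apply: val_inj.
- by move=> x y /(congr1 val); rewrite /= !to_bot_0.
- by move=> i y; apply: val_inj; rewrite /= mhom_to_bot.
- by exists h'.
Qed.

Lemma AR_Cok : in_S X -> ~ injective_in (@in_S R n.+1) X ->
  AR_sequence (@in_F R n.+1) (Cok_hom f) (Cok_hom g).
Proof.
move=> SX ninjX.
have ex : short_exact (Cok_hom f) (Cok_hom g).
  move=> i; split.
  - suff ker_f q : Cok_hom f i q = 0 -> q = 0 by apply: raddf_inj.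
    rewrite -[q]quotreprK /= quotmod_mapE => /eqP.
    rewrite -[X in _ == X -> _](linear0 (quotpi _)) quotpi_eq subr0 => fq.
    rewrite -(linear0 (quotpi _)); apply/eqP; rewrite quotpi_eq subr0.
    apply/in_CokP; case/in_CokP: fq => [fx|[j [y [e fx]]]].
      by left; apply: f_inj; rewrite fx linear0.
    have [x xE] := im_to_bot_pullback SX ninjX (esym fx).
    by right; exists j, x.
  - move=> q; split=> [|[x <-]]; last first.
      by rewrite -[x]quotreprK /= !quotmod_mapE gf0 linear0.
    rewrite -[q]quotreprK; set y := quotrepr q; rewrite /= quotmod_mapE => /eqP.
    rewrite -[X in _ == X -> _](linear0 (quotpi _)) quotpi_eq subr0 => gy.
    (* g(y) is zero or comes from Z_{i+1}; lifting to Y_{i+1} gives [y'], which is zero in the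
       cokernel, so [y - y'] represents the same class. *)
    have [y' y'i gy'] : exists2 y', y' \in Cok_sub Y i & g ord0 (y - y') = 0.
      case/in_CokP: gy => [gy|[j [z [e gy]]]].
        by exists 0; rewrite ?subr0 //; apply/in_CokP; left.
      have [y' y'z] := g_surj z; exists (to_bot Y j y').
        by apply/in_CokP; right; exists j, y'.
      by rewrite linearB mhom_to_bot y'z gy subrr.
    have [x xE] := fg_ker gy'; exists (quotpi _ x); rewrite quotmod_mapE xE.
    by apply/eqP; rewrite quotpi_eq addrAC subrr add0r rpredN.
  - move=> q; have [y yE] := g_surj (quotrepr q).
    by exists (quotpi _ y); rewrite /= quotmod_mapE yE quotreprK.
have nsplit_f : ~ split_mono (Cok_hom f).
  move=> [r rf]; apply: f_nsplit; have [t tE] := Cok_full r SX.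
  exists t => i x; apply: (to_bot_inj SX); apply: quotpi_max_inj.
  rewrite tE -[RHS]rf /=; congr (r _ _).
  by rewrite quotmod_mapE mhom_to_bot.
split; first by split=> //; apply: in_F_Cok.
  split=> // W FW h nsplit_h; have [k kE] := Ker_adj h.
  have [|l lE] := @f_ext _ k (in_S_Ker noeth FW.1).1.
    move=> [r rk]; apply: nsplit_h; have [u [uE _]] := Cok_unit X.
    (* A retraction r of [k] followed by the unit of [X] is a map Ker W -> Ker (Cok X); fullness of
       [Ker] turns it into a retraction of [h]. *)
    have [t tE] := Ker_full (mhom_comp u r) FW.
    exists t; apply: Cok_ext => x /=;
      rewrite -[x]to_bot_0 -kE tE /= uE to_bot_0.
    by have /= -> := rk ord0 x; rewrite to_bot_0.
  have [h' h'E] := Cok_adj l; exists h'; apply: Cok_ext => x /=.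
  by rewrite quotmod_mapE h'E from_top_max lE kE to_bot_0.
split=> [/(short_exact_split_epi ex)//|W FW h nsplit_h].
have [u [uE surj_u]] := Cok_unit Z; have [v [vE _]] := Cok_unit Y.
have SKC V : in_Mor V -> in_S (Ker (Cok V)).
  by move=> MV; apply: in_S_Ker => //; case: (in_F_Cok MV).
(* [h] is moved to S by [Ker], lifted there, and brought back by fullness of [Ker]. *)
have [|||||||m mE] := right_lift_S (u := u) (v := v) (g' := Ker_hom (Cok_hom g))
    (h := Ker_hom h) => //.
- exact: SKC.
- exact: SKC.
- by apply: in_S_Ker => //; case: FW.
- by move=> x y /(congr1 val); rewrite /= !uE => /quotpi_max_inj;
    rewrite !to_bot_0.
- by move=> i y; apply: val_inj; rewrite /= vE uE quotmod_mapE mhom_to_bot.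
- move=> [r hr]; apply: nsplit_h.
  have [t tE] := Ker_full r (in_F_Cok MZ).
  exists t; apply: F_ext; first exact: in_F_Cok.
  move=> z; have [x <-] := Ker0_surj z; rewrite /= tE.
  by have /(congr1 val) := hr ord0 x.
have [t tE] := Ker_full m FW; exists t; apply: F_ext => // w.
have [x <-] := Ker0_surj w; rewrite /= tE.
by have /(congr1 val) := mE ord0 x.
Qed.

End AlmostSplit.

Theorem proposition2p2 (k : comNzRingType) (A : algType k)
    (hA : artin_algebra A) (n : nat) (X Y Z : mseq A n.+2)
    (f : mhom X Y) (g : mhom Y Z) (hfg : AR_sequence (@in_Mor A n.+2) f g) :
  (in_F Z -> ~ projective_in (@in_F A n.+2) Z ->
     AR_sequence (@in_F A n.+2)
       (Epi_hom f) (mhom_comp (epi_counit Z) (Epi_hom g)) /\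
     AR_sequence (@in_S A n.+2) (Ker_hom f) (Ker_hom g)) /\
  (in_S X -> ~ injective_in (@in_S A n.+2) X ->
     AR_sequence (@in_S A n.+2)
       (mhom_comp (Mono_hom f) (mono_unit X)) (Mono_hom g) /\
     AR_sequence (@in_F A n.+2) (Cok_hom f) (Cok_hom g)).
Proof.
have noeth : fg_submodules A.
  by move=> V S; apply: (artin_algebra_fg_submod hA.1 S hA.2).
split=> [FZ nprojZ|SX ninjX]; split.
- exact: AR_Epi noeth _ _ _ _ _ hfg FZ nprojZ.
- exact: AR_Ker noeth _ _ _ _ _ hfg FZ nprojZ.
- exact: AR_Mono noeth _ _ _ _ _ hfg SX ninjX.
- exact: AR_Cok noeth _ _ _ _ _ hfg SX ninjX.
Qed.
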